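(* Let $k$ be a field, let $c\ge 1$, let $\mathbf{a}_c=(a_1,\dots,a_c)$ be a sequence of integers with $a_i\ge 2$, let $\mathbf{q}=(q_{ij})$ be a $c\times c$ commutation matrix with entries in $k$, and let $A=A_{\mathbf{q}}^{\mathbf{a}_c}$ be the corresponding quantum complete intersection. Suppose that all the commutators $q_{ij}$ are roots of unity. Then for all finitely generated $\mathbb{Z}^c$-graded left $A$-modules $M$ and $N$, the following are equivalent: (i) $\operatorname{Ext}_A^i(M,N)=0$ for $i\gg 0$; (ii) $\operatorname{Ext}_A^i(M,N)=0$ for all $i>0$; (iii) $\operatorname{Ext}_A^i(N,M)=0$ for $i\gg 0$; (iv) $\operatorname{Ext}_A^i(N,M)=0$ for all $i>0$.
   Context: A $c\times c$ commutation matrix over $k$ is a matrix $\mathbf{q}=(q_{ij})$ with entries in $k$ such that $q_{ii}=1$ for all $i$ and $q_{ij}q_{ji}=1$ for all $i,j$; its entries are called commutators. Given integers $a_1,\dots,a_c\ge 2$, the quantum complete intersection is the finite dimensional $k$-algebra $$A_{\mathbf{q}}^{\mathbf{a}_c}=k\langle X_1,\dots,X_c\rangle/(X_i^{a_i},\ X_iX_j-q_{ij}X_jX_i),$$ where $x_i$ denotes the image of $X_i$. It is $\mathbb{Z}^c$-graded, with $x_i$ in degree the $i$th unit vector, and a graded module is a module graded with respect to this $\mathbb{Z}^c$-grading. $\operatorname{Ext}_A^i$ is the usual Ext over the algebra $A$ (of the underlying ungraded modules). *)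

(* Defs.v *)
From HB Require Import structures.
From mathcomp Require Import all_boot all_order all_algebra.
From mathcomp Require Import finmap generic_quotient ring_quotient.
From mathcomp Require Import boolp.
From mathcomp.multinomials Require Import monalg.

Set Implicit Arguments.
Unset Strict Implicit.
Unset Printing Implicit Defensive.

Import GRing.Theory.
Local Open Scope ring_scope.
Local Open Scope quotient_scope.

Section IdealQuotient.
Variables (R : comNzRingType) (F : algType R).

Inductive two_sided_ideal (S : F -> Prop) : F -> Prop :=
| tsi_gen x : S x -> two_sided_ideal S x
| tsi_0 : two_sided_ideal S 0
| tsi_B x y :
    two_sided_ideal S x -> two_sided_ideal S y -> two_sided_ideal S (x - y)
| tsi_Ml r x : two_sided_ideal S x -> two_sided_ideal S (r * x)
| tsi_Mr x r : two_sided_ideal S x -> two_sided_ideal S (x * r).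

Variable S : F -> Prop.

Definition tsi_pred : pred F := fun x => `[< two_sided_ideal S x >].

Fact tsi_zmod_closed : zmod_closed tsi_pred.
Proof.
split; first by apply/asboolP/tsi_0.
by move=> x y /asboolP Sx /asboolP Sy; apply/asboolP/tsi_B.
Qed.
HB.instance Definition _ := GRing.isZmodClosed.Build F tsi_pred tsi_zmod_closed.
Definition tsi : zmodClosed F := GRing.ZmodClosed.clone F tsi_pred _.

Lemma tsi_predMl r x : x \in tsi_pred -> r * x \in tsi_pred.
Proof. by move=> /asboolP Sx; apply/asboolP/tsi_Ml. Qed.

Lemma tsi_predMr r x : x \in tsi_pred -> x * r \in tsi_pred.
Proof. by move=> /asboolP Sx; apply/asboolP/tsi_Mr. Qed.

(* algType requires 1 != 0, hence the properness argument.                    *)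
Definition quot_alg (proper : ~ two_sided_ideal S 1) : Type :=
  Quotient.quot tsi.

Variable proper : ~ two_sided_ideal S 1.
Local Notation Q := (quot_alg proper).

HB.instance Definition _ := GRing.Zmodule.on Q.

Definition quot_pi (x : F) : Q := \pi_(Quotient.quot tsi) x.

Lemma quot_piP x y : quot_pi x = quot_pi y <-> two_sided_ideal S (x - y).
Proof.
split=> [/eqP|Sxy]; last first.
  by apply/eqP; rewrite /quot_pi piE Quotient.equivE; apply/asboolP.
by rewrite /quot_pi piE Quotient.equivE => /asboolP.
Qed.

Definition quot_repr (x : Q) : F := repr (x : Quotient.quot tsi).

Lemma quot_reprK x : quot_pi (quot_repr x) = x.
Proof. exact: reprK. Qed.

Lemma quot_pi_ind (P : Q -> Prop) : (forall x, P (quot_pi x)) -> forall x, P x.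
Proof. by move=> PQ x; rewrite -[x]quot_reprK. Qed.

Fact quot_pi_zmod_morphism : zmod_morphism quot_pi.
Proof. by move=> x y; rewrite /quot_pi raddfB. Qed.
HB.instance Definition _ :=
  GRing.isZmodMorphism.Build F Q quot_pi quot_pi_zmod_morphism.

Definition quot_one : Q := quot_pi 1.
Definition quot_mul (x y : Q) : Q := quot_pi (quot_repr x * quot_repr y).
Definition quot_scale (a : R) (x : Q) : Q := quot_pi (a *: quot_repr x).

Lemma quot_piM x y : quot_mul (quot_pi x) (quot_pi y) = quot_pi (x * y).
Proof.
apply/quot_piP.
set x' := quot_repr _; set y' := quot_repr _.
have Ix : two_sided_ideal S (x' - x) by apply/quot_piP; rewrite quot_reprK.
have Iy : two_sided_ideal S (y' - y) by apply/quot_piP; rewrite quot_reprK.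
have -> : x' * y' - x * y = (x' - x) * y' - x * (y - y').
  by rewrite mulrBl mulrBr opprB addrA addrNK.
by apply: tsi_B; [apply: tsi_Mr | rewrite -opprB mulrN -mulNr; apply: tsi_Ml].
Qed.

Lemma quot_piZ a x : quot_scale a (quot_pi x) = quot_pi (a *: x).
Proof.
apply/quot_piP; rewrite -scalerBr -[_ - _]mul1r scalerAl; apply: tsi_Ml.
by apply/quot_piP; rewrite quot_reprK.
Qed.

Fact quot_mulA : associative quot_mul.
Proof.
elim/quot_pi_ind=> x; elim/quot_pi_ind=> y; elim/quot_pi_ind=> z.
by rewrite !quot_piM mulrA.
Qed.
Fact quot_mul1r : left_id quot_one quot_mul.
Proof. by elim/quot_pi_ind=> x; rewrite quot_piM mul1r. Qed.
Fact quot_mulr1 : right_id quot_one quot_mul.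
Proof. by elim/quot_pi_ind=> x; rewrite quot_piM mulr1. Qed.
Fact quot_mulDl : left_distributive quot_mul +%R.
Proof.
elim/quot_pi_ind=> x; elim/quot_pi_ind=> y; elim/quot_pi_ind=> z.
by rewrite -raddfD !quot_piM mulrDl raddfD.
Qed.
Fact quot_mulDr : right_distributive quot_mul +%R.
Proof.
elim/quot_pi_ind=> x; elim/quot_pi_ind=> y; elim/quot_pi_ind=> z.
by rewrite -raddfD !quot_piM mulrDr raddfD.
Qed.
Fact quot_1_neq0 : quot_one != 0.
Proof.
apply/eqP; rewrite -(raddf0 quot_pi) => /quot_piP; rewrite subr0.
exact: proper.
Qed.
HB.instance Definition _ := GRing.Zmodule_isNzRing.Build Q
  quot_mulA quot_mul1r quot_mulr1 quot_mulDl quot_mulDr quot_1_neq0.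

Fact quot_scaleA a b x : quot_scale a (quot_scale b x) = quot_scale (a * b) x.
Proof. by elim/quot_pi_ind: x => x; rewrite !quot_piZ scalerA. Qed.
Fact quot_scale1 : left_id 1 quot_scale.
Proof. by elim/quot_pi_ind=> x; rewrite quot_piZ scale1r. Qed.
Fact quot_scaleDr : right_distributive quot_scale +%R.
Proof.
move=> a; elim/quot_pi_ind=> x; elim/quot_pi_ind=> y.
by rewrite -raddfD !quot_piZ scalerDr raddfD.
Qed.
Fact quot_scaleDl x : {morph quot_scale^~ x : a b / a + b}.
Proof.
by move=> a b; elim/quot_pi_ind: x => x; rewrite !quot_piZ scalerDl raddfD.
Qed.
HB.instance Definition _ := GRing.Zmodule_isLmodule.Build R Q
  quot_scaleA quot_scale1 quot_scaleDr quot_scaleDl.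

Fact quot_scaleAl (a : R) (x y : Q) : a *: (x * y) = (a *: x) * y.
Proof.
elim/quot_pi_ind: x => x; elim/quot_pi_ind: y => y.
by rewrite /GRing.scale /GRing.mul /= !(quot_piM, quot_piZ) scalerAl.
Qed.
HB.instance Definition _ := GRing.Lmodule_isLalgebra.Build R Q quot_scaleAl.

Fact quot_scaleAr (a : R) (x y : Q) : a *: (x * y) = x * (a *: y).
Proof.
elim/quot_pi_ind: x => x; elim/quot_pi_ind: y => y.
by rewrite /GRing.scale /GRing.mul /= !(quot_piM, quot_piZ) scalerAr.
Qed.
HB.instance Definition _ := GRing.Lalgebra_isAlgebra.Build R Q quot_scaleAr.

Fact quot_pi_monoid_morphism : monoid_morphism quot_pi.
Proof. by split=> // x y; rewrite /GRing.mul /= quot_piM. Qed.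
HB.instance Definition _ :=
  GRing.isMonoidMorphism.Build F Q quot_pi quot_pi_monoid_morphism.

Fact quot_pi_scalable : scalable quot_pi.
Proof. by move=> a x; rewrite /GRing.scale /= quot_piZ. Qed.
HB.instance Definition _ :=
  GRing.isScalable.Build R F Q *:%R quot_pi quot_pi_scalable.

End IdealQuotient.


Fact malg_scaleAr (K : monomType) (R : comNzRingType) (s : R)
  (x y : {malg R[K]}) : s *: (x * y) = x * (s *: y).
Proof.
apply/malgP => m; rewrite mcoeffZ mcoeffMl.
rewrite (mcoeffMlw _ (fsubset_refl _) (msuppZ_le s y)) mulr_sumr.
apply: eq_bigr => i _; rewrite mulr_sumr; apply: eq_bigr => j _.
by rewrite mcoeffZ mulrnAr mulrCA.
Qed.
Section QuantumCompleteIntersection.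
Variables (k : fieldType) (c : nat).

Definition commutation_matrix (q : 'M[k]_c) : Prop :=
  (forall i, q i i = 1) /\ (forall i j, q i j * q j i = 1).

(* k<X_1, ..., X_c>: {fmonom I} is the free noncommutative monoid of words.   *)
Definition free_alg : Type := {malg k[{fmonom 'I_c}]}.
HB.instance Definition _ := GRing.Lalgebra.on free_alg.
HB.instance Definition _ :=
  GRing.Lalgebra_isAlgebra.Build k free_alg (@malg_scaleAr {fmonom 'I_c} k).

Definition freeX (i : 'I_c) : free_alg := << fmu i >>.

Variables (a : 'I_c -> nat) (q : 'M[k]_c).

Inductive qci_relator : free_alg -> Prop :=
| qci_power i : qci_relator (freeX i ^+ a i)
| qci_commute i j :
    qci_relator (freeX i * freeX j - q i j *: (freeX j * freeX i)).

Hypothesis a_ge2 : forall i, (2 <= a i)%N.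

Fact qci_proper : ~ two_sided_ideal qci_relator 1.
Proof.
pose eps : {rmorphism {malg k[{fmonom 'I_c}]} -> k} := mcoeff mone.
have X0 i : eps (freeX i) = 0 by rewrite /eps /= mcoeffU fm1_eq1.
have epsM (x y : free_alg) : eps (x * y) = eps x * eps y.
  exact: (rmorphM eps x y).
have epsB (x y : free_alg) : eps (x - y) = eps x - eps y.
  exact: (rmorphB eps x y).
have epsX (x : free_alg) n : eps (x ^+ n) = eps x ^+ n.
  exact: (rmorphXn eps n x).
have epsZ s (x : free_alg) : eps (s *: x) = s * eps x.
  exact: (mcoeffZ s (x : {malg k[{fmonom 'I_c}]})).
suff H (x : free_alg) : two_sided_ideal qci_relator x -> eps x = 0.
  by move=> /H /eqP; rewrite (rmorph1 eps) oner_eq0.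
elim=> {x} [_ [i|i j]||x y _ x0 _ y0|r x _ x0|x r _ x0].
- by rewrite epsX X0 expr0n; case: (a i) (a_ge2 i).
- by rewrite epsB epsZ !epsM !X0 !mulr0 subr0.
- exact: (rmorph0 eps).
- by rewrite epsB x0 y0 subr0.
- by rewrite epsM x0 mulr0.
- by rewrite epsM x0 mul0r.
Qed.

Definition qci : Type := quot_alg qci_proper.
HB.instance Definition _ := GRing.Algebra.on qci.

Definition qci_pi (f : free_alg) : qci := quot_pi qci_proper f.

(* Homogeneous elements of degree d: images of k-combinations of words in     *)
(* which each X_i occurs d_i times.                                           *)
Definition word_degree (w : {fmonom 'I_c}) : 'rV[int]_c :=
  \sum_(i <- (w : seq 'I_c)) delta_mx 0 i.

Definition qci_component (d : 'rV[int]_c) (x : qci) : Prop :=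
  exists2 f : free_alg,
    (forall w, w \in msupp f -> word_degree w = d) &
    x = qci_pi f.

End QuantumCompleteIntersection.

Section GradedModules.
Variables (k : fieldType) (c : nat) (a : 'I_c -> nat) (q : 'M[k]_c).
Variable a_ge2 : forall i, (2 <= a i)%N.
Variable M : lmodType (qci q a_ge2).

(* M is the internal direct sum of its subgroups component d; these are       *)
(* k-subspaces by componentZ, as k lies in degree 0.                          *)
Record grading := Grading {
  component : 'rV[int]_c -> M -> Prop;
  component0 : forall d, component d 0;
  componentB : forall d x y,
    component d x -> component d y -> component d (x - y);
  componentZ : forall d e r x,
    qci_component d r -> component e x -> component (d + e) (r *: x);
  component_span : forall x, exists (s : seq 'rV[int]_c) (u : 'rV[int]_c -> M),
    (forall d, component d (u d)) /\ x = \sum_(d <- s) u d;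
  component_direct : forall (s : seq 'rV[int]_c) (u : 'rV[int]_c -> M),
    uniq s -> (forall d, component d (u d)) -> \sum_(d <- s) u d = 0 ->
    forall d, d \in s -> u d = 0
}.

End GradedModules.

Definition finitely_generated (A : pzRingType) (M : lmodType A) : Prop :=
  exists s : seq M, forall x, exists r : 'I_(size s) -> A,
    x = \sum_(i < size s) r i *: s`_i.

Section Kernel.
Variables (A : pzRingType) (U V : lmodType A) (f : {linear U -> V}).

Definition ker_pred : pred U := fun x => f x == 0.

Fact ker_submod_closed : submod_closed ker_pred.
Proof.
split=> [|r x y]; first by rewrite unfold_in /ker_pred linear0.
rewrite !unfold_in /ker_pred => /eqP fx /eqP fy.
by rewrite linearP fx fy scaler0 addr0.
Qed.
HB.instance Definition _ := GRing.isSubmodClosed.Build A U ker_pred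
  ker_submod_closed.

Record ker := Ker { ker_val :> U; ker_valP : ker_val \in ker_pred }.
HB.instance Definition _ := [isSub for ker_val].
HB.instance Definition _ := [Choice of ker by <:].
HB.instance Definition _ := [SubChoice_isSubLmodule of ker by <:].

Definition ker_incl : {linear ker -> U} := \val.

End Kernel.

Section Hom.
Variables (A : pzRingType) (U V : lmodType A).

Definition Hom : Type := {linear U -> V}.
HB.instance Definition _ := gen_eqMixin Hom.
HB.instance Definition _ := gen_choiceMixin Hom.

Lemma HomP (f g : Hom) : f =1 g -> f = g.
Proof.
move=> fg; have {fg} : (f : U -> V) = g by apply/funext.
case: f g => [f [[f1] [f2]]] [g [[g1] [g2]]] /= fg.
rewrite {}fg in f1 f2 *.
by rewrite (Prop_irrelevance f1 g1) (Prop_irrelevance f2 g2).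
Qed.

Definition Hom0 : Hom := \0.
Definition HomN (f : Hom) : Hom := \- f.
Definition HomD (f g : Hom) : Hom := f \+ g.

Fact HomDA : associative HomD.
Proof. by move=> f g h; apply: HomP => x /=; rewrite addrA. Qed.
Fact HomDC : commutative HomD.
Proof. by move=> f g; apply: HomP => x /=; rewrite addrC. Qed.
Fact Hom0D : left_id Hom0 HomD.
Proof. by move=> f; apply: HomP => x /=; rewrite add0r. Qed.
Fact HomND : left_inverse Hom0 HomN HomD.
Proof. by move=> f; apply: HomP => x /=; rewrite addNr. Qed.
HB.instance Definition _ := GRing.isZmodule.Build Hom HomDA HomDC Hom0D HomND.

End Hom.

Section Precomposition.
Variables (A : pzRingType) (U V W : lmodType A) (d : {linear U -> V}).

Definition precomp (f : Hom V W) : Hom U W := f \o d.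

Fact precomp_zmod_morphism : zmod_morphism precomp.
Proof. by move=> f g; apply: HomP. Qed.
HB.instance Definition _ := GRing.isZmodMorphism.Build (Hom V W) (Hom U W)
  precomp precomp_zmod_morphism.

End Precomposition.

Section Cohomology.
Variables (C : nat -> zmodType) (delta : forall n, {additive C n -> C n.+1}).

Definition cocycle_pred n : pred (C n) := fun x => delta n x == 0.

Fact cocycle_zmod_closed n : zmod_closed (@cocycle_pred n).
Proof.
split=> [|x y]; rewrite !unfold_in /cocycle_pred ?raddf0 //.
by move=> /eqP dx /eqP dy; rewrite raddfB dx dy subr0.
Qed.
HB.instance Definition _ n := GRing.isZmodClosed.Build (C n)
  (@cocycle_pred n) (@cocycle_zmod_closed n).

Record cocycle n := Cocycle {
  cocycle_val :> C n; cocycleP : cocycle_val \in @cocycle_pred n }.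
HB.instance Definition _ n := [isSub for @cocycle_val n].
HB.instance Definition _ n := [Choice of cocycle n by <:].
HB.instance Definition _ n := [SubChoice_isSubZmodule of cocycle n by <:].

(* The incoming differential at 0 is the zero map.                            *)
Definition is_coboundary n : C n -> Prop :=
  match n with
  | 0 => fun x => x = 0
  | m.+1 => fun x => exists y, x = delta m y
  end.

Definition coboundary_pred n : pred (cocycle n) :=
  fun z => `[< is_coboundary (z : C n) >].

Fact coboundary_zmod_closed n : zmod_closed (@coboundary_pred n).
Proof.
split=> [|x y].
  apply/asboolP; have z0 : (0 : cocycle n) = 0 :> C n by exact: GRing.val0.
  by case: n z0 => [|n] //= ->; exists 0; rewrite raddf0.
move=> /asboolP Bx /asboolP By; apply/asboolP.
have -> : cocycle_val (x - y) = cocycle_val x - cocycle_val y.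
  exact: GRing.valB.
case: n x y Bx By => [|n] x y /=; first by move=> -> ->; rewrite subr0.
by move=> [u ->] [v ->]; exists (u - v); rewrite raddfB.
Qed.
HB.instance Definition _ n := GRing.isZmodClosed.Build (cocycle n)
  (@coboundary_pred n) (@coboundary_zmod_closed n).
Definition coboundary n : zmodClosed (cocycle n) :=
  GRing.ZmodClosed.clone (cocycle n) (@coboundary_pred n) _.

Definition cohomology n : zmodType := Quotient.quot (coboundary n).

End Cohomology.

(* {malg A[K]} is the free left A-module on the basis << x >>, x : K.         *)
Section FreeModule.
Variables (A : nzRingType) (K : choiceType) (V : lmodType A) (phi : K -> V).

Definition free_ext (g : {malg A[K]}) : V := \sum_(x <- msupp g) g@_x *: phi x.

Lemma free_extEw (D : {fset K}) (g : {malg A[K]}) :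
  (msupp g `<=` D)%fset -> free_ext g = \sum_(x <- D) g@_x *: phi x.
Proof.
move=> sgD; apply: big_fset_incl => // x _ /mcoeff_outdom ->.
by rewrite scale0r.
Qed.

Fact free_ext_linear : linear free_ext.
Proof.
move=> r f g; pose D := (msupp f `|` msupp g)%fset.
have sf : (msupp f `<=` D)%fset by apply: fsubsetUl.
have sg : (msupp g `<=` D)%fset by apply: fsubsetUr.
have srf : (msupp (r *: f) `<=` D)%fset.
  by apply: fsubset_trans (msuppZ_le _ _) sf.
rewrite (free_extEw sf) (free_extEw sg) (@free_extEw D); last first.
  by apply: fsubset_trans (msuppD_le _ _) _; rewrite fsubUset srf.
rewrite scaler_sumr -big_split /=; apply: eq_bigr => x _.
by rewrite mcoeffD mcoeffZ scalerDl scalerA.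
Qed.
HB.instance Definition _ := GRing.isLinear.Build A {malg A[K]} V *:%R
  free_ext free_ext_linear.

Lemma free_extU x : free_ext << x >> = phi x.
Proof. by rewrite (free_extEw msuppU_le) big_seq_fset1 mcoeffUU scale1r. Qed.

End FreeModule.

Lemma free_ext_eq (A : nzRingType) (K : choiceType) (V : lmodType A)
    (f : {linear {malg A[K]} -> V}) : f =1 free_ext (fun x => f << x >>).
Proof.
move=> g; rewrite {1}[g]monalgE linear_sum; apply: eq_bigr => x _.
rewrite -linearZ; congr (f _); apply/malgP => y.
by rewrite mcoeffZ !mcoeffU mulrnAr mulr1.
Qed.

Lemma free_projective (A : nzRingType) (K : choiceType) (V W : lmodType A)
    (g : {linear V -> W}) (f : {linear {malg A[K]} -> W}) :
  (forall w, exists v, g v = w) -> exists h : {linear {malg A[K]} -> V},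
    forall x, g (h x) = f x.
Proof.
move=> gsurj; have [phi phiP] := choice (fun x => gsurj (f << x >>)).
exists (free_ext phi) => x; rewrite (free_ext_eq f) /free_ext linear_sum.
by apply: eq_bigr => y _; rewrite linearZ /= phiP.
Qed.

Definition cover (A : nzRingType) (M : lmodType A) :
  {linear {malg A[M]} -> M} := free_ext idfun.
Arguments cover {A} M.

Lemma cover_surj (A : nzRingType) (M : lmodType A) x :
  exists g, cover M g = x.
Proof. by exists << x >>; rewrite /cover /= free_extU. Qed.

Lemma cover_exact (A : nzRingType) (M : lmodType A) (x : {malg A[M]}) :
  cover M x = 0 <-> exists y, x = ker_incl (cover M) (cover _ y).
Proof.
split=> [/eqP x0|[y ->]]; last first.
  by case: (cover _ y) => z zP; apply/eqP.
by have [y yx] := cover_surj (Ker x0); exists y; rewrite yx.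
Qed.

(* The standard free resolution of M, obtained by iterating K |-> ker (A[K] ->*)
(* K): res n is free on the underlying set of the n-th syzygy module.         *)
Section Resolution.
Variables (A : nzRingType) (M : lmodType A).

Fixpoint syzygy (n : nat) : lmodType A :=
  match n with
  | 0 => M
  | m.+1 => ker (cover (syzygy m))
  end.

Definition res (n : nat) : lmodType A := {malg A[syzygy n]}.

Definition res_d (n : nat) : {linear res n.+1 -> res n} :=
  ker_incl (cover (syzygy n)) \o cover (syzygy n.+1).

Definition res_aug : {linear res 0 -> M} := cover M.

Lemma res_aug_surj x : exists y, res_aug y = x.
Proof. exact: cover_surj. Qed.

Lemma res_aug_exact x : res_aug x = 0 <-> exists y, x = res_d 0 y.
Proof. exact: cover_exact. Qed.

Lemma res_exact n x : res_d n x = 0 <-> exists y, x = res_d n.+1 y.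
Proof.
rewrite -cover_exact; split=> [x0|x0]; last by rewrite /= x0; exact: GRing.val0.
exact: (@val_inj _ _ (ker (cover (syzygy n)))).
Qed.

End Resolution.

(* Ext^n_A(M, N) as H^n(Hom_A(P, N)) for the standard free resolution P of M. *)
Definition Ext (A : nzRingType) (n : nat) (M N : lmodType A) : zmodType :=
  @cohomology (fun i => Hom (res M i) N) (fun i => @precomp A _ _ N (res_d M i))
    n.

Definition Ext_vanishes (A : nzRingType) (n : nat) (M N : lmodType A) : Prop :=
  forall x : Ext n M N, x = 0.

(* Main.v *)
From HB Require Import structures.
Require Import Defs.
From mathcomp Require Import all_boot all_order all_algebra zify ring.
From mathcomp Require Import finmap generic_quotient ring_quotient.
From mathcomp Require Import boolp classical_sets functions.
From mathcomp.multinomials Require Import monalg.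
Set Implicit Arguments.
Unset Strict Implicit.
Unset Printing Implicit Defensive.
Import Order.TTheory GRing.Theory Num.Theory.
Local Open Scope ring_scope.

(** On k-linear maps f : M -> N consider D_i f = x_i f - f x_i and
    E_i f = sum_l x_i^l f x_i^(a_i - 1 - l). The grading of N provides
    automorphisms phi_i with phi_i x_l = q_li x_l phi_i; composing with their
    powers makes D_i and E_i preserve the space H_s(M, N) of maps commuting with
    x_l for l in s, i not in s. If M is free over A, the pair (D_i,
        E_i) is exact
    on H_s(M, N), and ker D_i = H_{s + i}(M, N). Hence, for a free resolution P
    of M, the cohomology of H_s(P, N) controls that of H_{s + i}(P, N) through a
    two-periodicity, the case s = {} is acyclic, and Ext_A(M, N) is the case
    s = {1, ..., c}. As D_i is nilpotent,
        vanishing for large degrees passes from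
    s + i to s, and one concludes that Ext_A^n(M, N) = 0 for n >> 0 forces
    (D_i, E_i) to be exact on Hom_k(M, N) for every i. Conversely, exactness for
    every i on Hom_k(M, N) passes to all H_s(M, N),
        the grading in degree j being
    bounded, and gives Ext_A^n(M, N) =
        0 for all n > 0. The criterion is symmetric
    in M and N because (D_i, E_i) on Hom_k(N, M) is, up to sign, the transpose
    for the trace form of (D_i, E_i) on Hom_k(M, N). *)

(** * Complexes with a two-periodic exact pair of operators *)

(** Up to the automorphism phi_i, the pair (D_i, E_i) on Hom_k(M, N) is the two-periodic complex
    induced by the bimodule resolution of k[x]/(x^(a_i)). Its exactness says that Ext over the
    subalgebra generated by x_i vanishes in positive degrees, so the criterion reduces Ext over A to
    c algebras in one variable. The twist is forced: if f commutes with x_l, then x_i f and f x_i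
    commute with x_l only up to the scalar q_il. It is the same scalar for both, so a single
    automorphism contributing q_li repairs the two terms at once. Exactness on a space does not
    restrict to subspaces in general. It restricts to ker D_j because D_j and E_j strictly raise the
    x_j-degree of a map, while D_i and E_i preserve it for i different from j. Duality is applied on
    the full space Hom_k(M, N), where phi_i can be divided out; this is why the criterion lives
    there and not on some H_s. *)

Definition sub_closed (V : zmodType) (S : V -> Prop) : Prop :=
  S 0 /\ forall x y, S x -> S y -> S (x - y).

(** Only the inclusion of kernels in images. The reverse one, [T b (T (~~ b) f) = 0], is kept apart
    because for the operators below it holds whatever M and N are. *)
Definition exact_pair (V : zmodType) (T : bool -> V -> V) (S : V -> Prop) :=
  forall b f, S f -> T b f = 0 -> exists2 g, S g & f = T (~~ b) g.

Section Complexes.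
Variables (V : nat -> zmodType) (delta : forall n, {additive V n -> V n.+1}).
Variable T : forall n, bool -> {additive V n -> V n}.
Variable S : forall n, V n -> Prop.
Arguments T {n}.
Arguments delta {n}.
Arguments S {n}.

(** The index is shifted: this is vanishing of cohomology in degree [n.+1], so that degree 0 needs
    no convention. *)
Definition acyclic (R : forall n, V n -> Prop) (n : nat) : Prop :=
  forall f : V n.+1, R n.+1 f -> delta f = 0 -> exists2 g, R n g & f = delta g.

Hypotheses (S_sub : forall n, sub_closed (@S n))
  (S_delta : forall n (f : V n), S f -> S (delta f))
  (S_T : forall n b (f : V n), S f -> S (T b f))
  (deltaT : forall n b (f : V n), delta (T b f) = T b (delta f))
  (TT : forall n b (f : V n), S f -> T b (T (~~ b) f) = 0)
  (delta2 : forall n (f : V n), S f -> delta (delta f) = 0)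
  (S_exact : forall n, exact_pair (@T n) S).

Definition kerT b n (f : V n) := S f /\ T b f = 0.
Definition zero_cocycle (f : V 0%N) := S f /\ delta f = 0.

Let SB n (f g : V n) : S f -> S g -> S (f - g).
Proof. exact: (S_sub n).2. Qed.

(** Modulo coboundaries every cocycle is [T true] of a cocycle, so [T true] is surjective on
    cohomology; as it is also nilpotent, the cohomology vanishes. *)
Lemma acyclic_of_kernel (n0 m : nat) :
  (forall n (f : V n), S f -> iter m (T true) f = 0) ->
  (forall n, (n0 <= n)%N -> acyclic (kerT true) n) ->
  forall n, (n0 <= n)%N -> acyclic (@S) n.
Proof.
move=> Tnil acK n n0n f Sf df.
(* Two corrections: [e'] is chosen so that [T false] kills [h - delta e'], and [g'] turns the
   preimage [g] of that difference under [T true] into a cocycle. They use the kernel complex at the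
   indices [n] and [n.+1]. *)
have step (h : V n.+1) : S h -> delta h = 0 -> exists g e : V _,
    [/\ S g, delta g = 0, S e & h = delta e + T true g].
  move=> Sh dh.
  have [||e [Se Te] eE] := acK n n0n (T false h).
  - by split; [exact: S_T | exact: (TT true)].
  - by rewrite deltaT dh raddf0.
  have [e' Se' e'E] := S_exact Se Te.
  have S1 : S (h - delta e') by apply: SB => //; exact: S_delta.
  have T1 : T false (h - delta e') = 0.
    by rewrite raddfB eE -deltaT e'E subrr.
  have [g Sg gE] := S_exact S1 T1.
  have dTg : T true (delta g) =
      0 by rewrite -deltaT -gE raddfB dh delta2 ?subr0.
  have [|||g' [Sg' Tg'] g'E] := acK n.+1 _ (delta g).
  - exact: leqW.
  - by split=> //; exact: S_delta.
  - by apply: delta2.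
  exists (g - g'), e'; split=> //; first exact: SB.
    by rewrite raddfB g'E subrr.
  by rewrite raddfB Tg' subr0 -gE addrC subrK.
have iterB r (x y : V n.+1) : iter r (T true) (x + y) =
    iter r (T true) x + iter r (T true) y.
  by elim: r => //= r ->; rewrite raddfD.
have iterd r (x : V n) : iter r (T true) (delta x) = delta (iter r (T true) x).
  by elim: r => //= r ->; rewrite deltaT.
have iterS r (x : V n) : S x -> S (iter r (T true) x).
  by move=> Sx; elim: r => //= r IH; exact: S_T.
have SD (x y : V n) : S x -> S y -> S (x + y).
  move=> Sx Sy; rewrite -[y]opprK; apply: SB => //; rewrite -[- y]sub0r.
  by apply: SB => //; exact: (S_sub _).1.
have [g [e [Sg dg Se ->]]] : exists g e : V _,
    [/\ S g, delta g = 0, S e & f = delta e + iter m (T true) g].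
  elim: m {Tnil} => [|r [g [e [Sg dg Se ->]]]].
    by exists f, 0; split=> //; [exact: (S_sub _).1 | rewrite raddf0 add0r].
  have [g' [e' [Sg' dg' Se' gE]]] := step g Sg dg.
  exists g', (e + iter r (T true) e'); split=> //.
    by apply: SD => //; exact: iterS.
  by rewrite gE iterB iterd raddfD -addrA -iterSr.
by rewrite Tnil // addr0; exists e.
Qed.

(** [T b] makes [kerT b], [S], [kerT (~~ b)] a short exact sequence of complexes; this is one half
    of the resulting dimension shift. *)
Let kernel_step b n : acyclic (@S) n -> acyclic (@S) n.+1 ->
  acyclic (kerT (~~ b)) n -> acyclic (kerT b) n.+1.
Proof.
move=> ac0 ac1 acK f [Sf Tf] df.
have [g Sg gE] := ac1 f Sf df.
have [||h [Sh Th] hE] := acK (T b g).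
- by split; [exact: S_T | rewrite -{2}[b]negbK TT].
- by rewrite deltaT -gE.
have [h' Sh' h'E] := S_exact Sh Th; rewrite negbK in h'E.
exists (g - delta h'); last by rewrite raddfB delta2 ?subr0.
split; first by apply: SB => //; exact: S_delta.
by rewrite raddfB -deltaT -h'E hE subrr.
Qed.

(** The other half of the dimension shift, towards lower degrees. *)
Let kernel_step_down b n : acyclic (@S) n ->
  acyclic (kerT b) n.+1 -> acyclic (kerT (~~ b)) n.
Proof.
move=> ac0 acK f [Sf Tf] df.
have [g Sg gE] := S_exact Sf Tf; rewrite negbK in gE.
have [||g' [Sg' Tg'] g'E] := acK (delta g).
- by split; [exact: S_delta | rewrite -deltaT -gE].
- by apply: delta2.
have [||h Sh hE] := ac0 (g - g'); first exact: SB.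
  by rewrite raddfB g'E subrr.
exists (T b h); first by split; [exact: S_T | rewrite -{2}[b]negbK TT].
by rewrite deltaT -hE raddfB Tg' subr0.
Qed.

(** Dimension shifting upwards. At the bottom a primitive [g] of [f] need not lie in the kernel;
    exactness on degree-0 cocycles supplies the cocycle by which it is corrected. *)
Lemma kernel_acyclic : (forall n, acyclic (@S) n) ->
  exact_pair (@T 0) zero_cocycle -> forall n b, acyclic (kerT b) n.
Proof.
move=> ac ex; elim=> [|n IH] b; last by apply: kernel_step;
    [exact: ac|exact: ac|].
move=> f [Sf Tf] df; have [g Sg gE] := ac _ f Sf df.
have [||h [Sh dh] hE] := ex (~~ b) (T b g).
- by split; [exact: S_T | rewrite deltaT -gE].
- by rewrite -{2}[b]negbK TT.
rewrite negbK in hE.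
exists (g - h); last by rewrite raddfB dh subr0.
by split; [exact: SB | rewrite raddfB hE subrr].
Qed.

(** Dimension shifting downwards carries the vanishing from large degrees to all degrees and both
    values of [b]; the lowest degree then gives exactness on degree-0 cocycles. *)
Lemma exact_zero_cocycles n0 : (forall n, acyclic (@S) n) ->
  (forall n, (n0 <= n)%N -> acyclic (kerT true) n) ->
  exact_pair (@T 0) zero_cocycle.
Proof.
move=> ac acK.
(* [m] makes up the distance from [n] to [n0]; each step down exchanges the two values of [b]. *)
have acKb m : forall n b, (n0 <= n + m)%N -> acyclic (kerT b) n.
  elim: m => [|m IH] n b; last first.
    rewrite addnS -addSn => le; rewrite -[b]negbK.
    by apply: kernel_step_down => //; exact: IH.
  rewrite addn0 => le; case: b; first exact: acK.
  by apply: (@kernel_step_down true) => //; apply: acK; exact: leqW.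
move=> b f [Sf df] Tf; have [g Sg gE] := S_exact Sf Tf.
have [|||g' [Sg' Tg'] g'E] := acKb n0 0%N (~~ b) _ (delta g).
- by rewrite add0n.
- by split; [exact: S_delta | rewrite -deltaT -gE].
- by apply: delta2.
exists (g - g'); last by rewrite raddfB Tg' subr0.
by split; [exact: SB | rewrite raddfB g'E subrr].
Qed.

End Complexes.

(** * Restricting exactness to a kernel by means of a bounded grading *)

Section GradedExactness.
Variables (V : zmodType) (S : V -> Prop) (T U : bool -> {additive V -> V}).
Variables (pr : int -> {additive V -> V}) (t : bool -> int) (B m : nat).
Hypotheses (S_sub : sub_closed S)
  (S_T : forall b v, S v -> S (T b v)) (S_U : forall b v, S v -> S (U b v))
  (S_pr : forall e v, S v -> S (pr e v)).
Hypotheses (TT : forall b v, S v -> T b (T (~~ b) v) = 0)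
  (UU : forall b v, S v -> U b (U (~~ b) v) = 0)
  (T_exact : exact_pair T S) (U_exact : exact_pair U S).
(** In the application the two pairs commute up to nonzero scalars. As [V] is only a group here,
    this is expressed by its two consequences. *)
Hypotheses (UT0 : forall b b' v, S v -> U b' (T b v) = 0 -> T b (U b' v) = 0)
  (TU_swap : forall b b' v, S v ->
     exists2 w, S w & T b (U b' v) = U b' (T b w)).
Hypotheses (t_gt0 : forall b, 0 < t b)
  (pr_low : forall e v, e < - B%:Z -> pr e v = 0)
  (pr_sum : forall v, S v -> v = \sum_(i < m) pr (i%:Z - B%:Z) v)
  (pr_pr : forall e v, S v -> pr e (pr e v) = pr e v)
  (T_pr : forall b e v, S v -> T b (pr e v) = pr (e + t b) (T b v))
  (U_pr : forall b e v, S v -> U b (pr e v) = pr e (U b v)).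

(* A kernel element of [T] in degree [e] is the [T]-image of an element of
   smaller degree, so that the induction ends by boundedness of the grading. *)
Let homogeneous_exact (n : nat) : forall e b b' z, e < n%:Z - B%:Z ->
  S z -> pr e z = z -> T b z = 0 -> U b' z = 0 ->
  exists w, [/\ S w, T b w = 0 & z = U (~~ b') w].
Proof.
elim: n => [|n IH] e b b' z lt_e Sz ez Tz Uz.
  exists 0; split; rewrite ?raddf0 //; first exact: S_sub.1.
  by rewrite -ez pr_low // -[- _]add0r.
have [y0 Sy0 y0E] := T_exact Sz Tz.
have [y [Sy ey yE]] : exists y,
    [/\ S y, pr (e - t (~~ b)) y = y & z = T (~~ b) y].
  exists (pr (e - t (~~ b)) y0); split; [exact: S_pr | exact: pr_pr |].
  by rewrite T_pr // subrK -y0E.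
(* [y] lifts [z], but [U b' y] may be nonzero. It has smaller degree and is killed by [T (~~ b)] and
   [U (~~ b')], so the induction gives [w'] such that [y - w'] still lifts [z] and is killed by
   [U b']. *)
have [|||||w' [Sw' Tw' w'E]] := IH (e - t (~~ b)) (~~ b) (~~ b') (U b' y).
- by have := t_gt0 (~~ b); lia.
- exact: S_U.
- by rewrite -U_pr // ey.
- by apply: UT0; rewrite -?yE.
- by rewrite -{2}[b']negbK; exact: UU.
rewrite negbK in w'E.
have [||u Su uE] := U_exact (_ : S (y - w')) (_ : U b' (y - w') = 0).
- exact: S_sub.2.
- by rewrite raddfB w'E subrr.
have [u' Su' u'E] := TU_swap (~~ b) (~~ b') Su.
exists (T (~~ b) u'); split; [exact: S_T | exact: TT |].
by rewrite -u'E -uE raddfB Tw' subr0.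
Qed.

Lemma graded_kernel_exact b : exact_pair U (fun v => S v /\ T b v = 0).
Proof.
move=> b' z [Sz Tz] Uz.
have H (i : 'I_m) :
    exists w, [/\ S w, T b w = 0 & pr (i%:Z - B%:Z) z = U (~~ b') w].
  apply: (@homogeneous_exact m (i%:Z - B%:Z)); rewrite ?pr_pr //.
  - by have := ltn_ord i; lia.
  - exact: S_pr.
  - by rewrite T_pr // Tz raddf0.
  - by rewrite U_pr // Uz raddf0.
have [w wP] := choice H.
exists (\sum_i w i); last first.
  by rewrite {1}(pr_sum Sz) raddf_sum; apply: eq_bigr => i _; have [] := wP i.
split; last by rewrite raddf_sum big1 // => i _; have [] := wP i.
apply: big_ind => [|x y Sx Sy|i _]; first exact: S_sub.1.
  rewrite -[y]opprK; apply: S_sub.2 => //; rewrite -[- y]sub0r.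
  by apply: S_sub.2 => //; exact: S_sub.1.
by have [] := wP i.
Qed.

End GradedExactness.

(** * Extension of linear maps *)

Section LinearExtension.
Variables (k : fieldType) (X Y N : lmodType k) (u : X -> Y) (f : X -> N).
Hypotheses (u_lin : linear u) (f_lin : linear f).

Definition functional_subspace (A : Y * N -> Prop) : Prop :=
  (forall a p q, A p -> A q -> A (a *: p + q)) /\ (forall n, A (0, n) -> n = 0).

Let G (p : Y * N) : Prop := exists x, p = (u x, f x).

Let G_lin a p q : G p -> G q -> G (a *: p + q).
Proof.
by move=> [x ->] [y ->]; exists (a *: x + y); rewrite u_lin f_lin.
Qed.

(** [f] factors through the image of [u], and the factor extends to all of [Y] by Zorn's lemma on
    functional graphs, as the terms of a resolution may have infinite dimension. *)
Lemma linear_factor : (forall x, u x = 0 -> f x = 0) ->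
  exists2 g : Y -> N, linear g & forall x, f x = g (u x).
Proof.
move=> uf0.
(* The condition is imposed on the union with the graph [G], so that the empty chain also has an
   upper bound. *)
have [|A [[Alin A0] Amax]] :=
    @Zorn_bigcup _ (fun A : set (Y * N) => functional_subspace (fun p =>
        A p \/ G p)).
  move=> F FP Ftot; split=> [a p q|n]; last first.
    by case=> [[Z FZ Zn]|[x [u0 ->]]]; [apply: (FP _ FZ).2; left | exact: uf0].
  have FZ Z p' q' : F Z -> Z p' \/ G p' -> Z q' \/ G q' ->
      bigcup F id (a *: p' + q') \/ G (a *: p' + q').
    move=> FZ Zp Zq; have [|?] := (FP _ FZ).1 a _ _ Zp Zq; last by right.
    by left; exists Z.
  case=> [[Z1 F1 Zp]|Gp] [[Z2 F2 Zq]|Gq].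
  - have [Z12|Z21] := Ftot _ _ F1 F2.
      by apply: (FZ Z2) => //; left=> //; exact: Z12.
    by apply: (FZ Z1) => //; left=> //; exact: Z21.
  - by apply: (FZ Z1) => //; [left|right].
  - by apply: (FZ Z2) => //; [right|left].
  - by right; exact: G_lin.
pose A' p := A p \/ G p.
have A'0 : A' 0.
  right; exists 0; have zero0 (W : lmodType k) (h : X -> W) : linear h -> h 0 =
      0.
    by move=> hl; have := hl (-1) 0 0; rewrite scaler0 addr0 scaleN1r addNr.
  by rewrite !zero0.
have A'Z a p : A' p -> A' (a *: p) by move=> Ap; rewrite -[_ *: _]addr0;
    exact: Alin.
have A'D p q : A' p -> A' q -> A' (p + q).
  by move=> Ap Aq; rewrite -[p]scale1r; exact: Alin.
have A'tot y0 : exists n, A' (y0, n).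
  apply: contrapT => no.
  (* The graph extended by sending [y0] to 0; it is functional because [y0] is outside the current
     domain. *)
  pose B (p : Y * N) := exists c q, A' q /\ p = (q.1 + c *: y0, q.2).
  have BG p : B p \/ G p -> B p.
    case=> // Gp; exists 0, p; split; first by right.
    by rewrite scale0r addr0; case: p {Gp}.
  have [] := Amax B.
    split=> [p Ap|BA].
      exists 0, p; split; first by left.
      by rewrite scale0r addr0; case: p {Ap}.
    apply: no; exists 0; left; apply: BA; exists 1, 0; split=> //=.
    by rewrite add0r scale1r.
  split=> [a p q /BG[c [p' [Ap ->]]] /BG[d [q' [Aq ->]]]|n /BG[c [q [Aq [q1
      ->]]]]].
    left; exists (a * c + d), (a *: p' + q'); split; first exact: Alin.
    by congr (_, _) => /=; rewrite scalerDr scalerDl scalerA addrACA.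
  have [c0|c0] := eqVneq c 0.
    have q10 : q.1 = 0 by move: q1; rewrite c0 scale0r addr0.
    by apply: A0; rewrite -q10 -surjective_pairing.
  case: no; exists (- c^-1 *: q.2).
  have := A'Z (- c^-1) _ Aq; congr A'; rewrite [LHS]surjective_pairing /=.
  congr (_, _); have -> : q.1 = - (c *: y0) by apply/eqP; rewrite -addr_eq0 -q1.
  by rewrite scalerN scaleNr opprK scalerA mulVf ?scale1r.
have [g gP] := choice A'tot.
have A'fun y n : A' (y, n) -> n = g y.
  move=> Ayn; apply/eqP; rewrite -subr_eq0; apply/eqP/A0.
  have := A'D _ _ Ayn (A'Z (-1) _ (gP y)); congr A'.
  by rewrite scaleN1r; congr (_, _); rewrite /= subrr.
exists g => [a y z|x]; last by apply: A'fun; right; exists x.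
by symmetry; apply: A'fun; exact: (Alin a _ _ (gP y) (gP z)).
Qed.

End LinearExtension.

(** * Commutator and norm operators on spaces of linear maps *)

Section OperatorPairs.
Variables (k : fieldType) (V : lmodType k) (n : nat) (A B : {linear V -> V}).

(** The two factors of A^(n+1) - B^(n+1) for commuting A and B; their product vanishes when both
    (n+1)-st powers do. *)
Definition pair_op (b : bool) (v : V) : V :=
  if b then A v - B v else \sum_(l < n.+1) iter l A (iter (n - l) B v).

Lemma iter_linear m (C : {linear V -> V}) : linear (iter m C).
Proof. by move=> a x y; elim: m => //= m ->; rewrite linearP. Qed.

Fact pair_op_linear b : linear (pair_op b).
Proof.
move=> a x y; case: b; rewrite /pair_op.
  by rewrite (linearP A) (linearP B) scalerBr opprD addrACA.
rewrite scaler_sumr -big_split; apply: eq_bigr => l _ /=.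
by rewrite !iter_linear.
Qed.
HB.instance Definition _ b :=
  GRing.isLinear.Build k V V *:%R (pair_op b) (pair_op_linear b).

Variable S : V -> Prop.
Hypotheses (S_sub : sub_closed S)
  (SA : forall v, S v -> S (A v)) (SB : forall v, S v -> S (B v)).

Let S_iterA m v : S v -> S (iter m A v).
Proof. by move=> Sv; elim: m => //= m; exact: SA. Qed.
Let S_iterB m v : S v -> S (iter m B v).
Proof. by move=> Sv; elim: m => //= m; exact: SB. Qed.

Lemma pair_op_stable b v : S v -> S (pair_op b v).
Proof.
case: S_sub => S0 SM; case: b => Sv; rewrite /pair_op.
  by apply: SM; [exact: SA|exact: SB].
apply: big_ind => [//|x y Sx Sy|l _]; last exact/S_iterA/S_iterB.
by rewrite -[y]opprK; apply: (SM) => //; rewrite -[- y]sub0r; exact: SM.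
Qed.

(** Both operators are homogeneous polynomials in A and B, of degrees 1 and [n], whence the exponent
    of [r]. *)
Lemma pair_op_swap (Z : {linear V -> V}) (r : k) :
  (forall v, S v -> A (Z v) = r *: Z (A v)) ->
  (forall v, S v -> B (Z v) = r *: Z (B v)) ->
  forall b v, S v -> pair_op b (Z v) =
      r ^+ (if b then 1 else n) *: Z (pair_op b v).
Proof.
move=> AZ BZ b v Sv; case: b; rewrite /pair_op.
  by rewrite AZ // BZ // expr1 linearB scalerBr.
have iterZ (C : {linear V -> V}) m x u : iter m C (x *: u) = x *: iter m C u.
  by elim: m => //= m ->; rewrite linearZ.
rewrite linear_sum scaler_sumr; apply: eq_bigr => l _.
have -> : iter (n - l) B (Z v) = r ^+ (n - l) *: Z (iter (n - l) B v).
  elim: (n - l)%N => [|m IH]; first by rewrite scale1r.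
  by rewrite !iterS IH linearZ /= BZ ?scalerA -?exprSr //; exact: S_iterB.
have iterAZ m u : S u -> iter m A (Z u) = r ^+ m *: Z (iter m A u).
  move=> Su; elim: m => [|m IH]; first by rewrite scale1r.
  by rewrite !iterS IH linearZ /= AZ ?scalerA -?exprSr //; exact: S_iterA.
rewrite iterZ iterAZ ?scalerA.
  by rewrite -exprD (subnK (leq_ord l)).
exact: S_iterB.
Qed.

Hypothesis AB : forall v, A (B v) = B (A v).
Hypotheses (A_nil : forall v, S v -> iter n.+1 A v = 0)
  (B_nil : forall v, S v -> iter n.+1 B v = 0).

Let iter_BA m v : iter m B (A v) = A (iter m B v).
Proof. by elim: m => //= m ->; rewrite AB. Qed.

Let iter_AB m v : iter m A (B v) = B (iter m A v).
Proof. by elim: m => //= m ->; rewrite AB. Qed.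

Let pair_op_sum v : S v ->
  \sum_(l < n.+1) (A (iter l A (iter (n - l) B v)) -
                   B (iter l A (iter (n - l) B v))) = 0.
Proof.
move=> Sv; pose C l := iter l A (iter (n.+1 - l) B v).
transitivity (\sum_(0 <= l < n.+1) (C l.+1 - C l)).
  rewrite big_mkord; apply: eq_bigr => l _; rewrite /C subSS -iter_AB.
  by rewrite (subSn (leq_ord l)).
by rewrite telescope_sumr // /C subnn subn0 A_nil // /= -iterS B_nil // subrr.
Qed.

Lemma pair_opK b v : S v -> pair_op b (pair_op (~~ b) v) = 0.
Proof.
move=> Sv; case: b; rewrite /pair_op /=.
  by rewrite -[RHS](pair_op_sum Sv) sumrB !linear_sum.
rewrite -[RHS](pair_op_sum Sv); apply: eq_bigr => l _.
have iterB (C : {linear V -> V}) m x y : iter m C (x - y) =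
    iter m C x - iter m C y.
  by elim: m => //= m ->; rewrite linearB.
by rewrite !iterB iter_BA -!iterSr !iterS iter_AB.
Qed.

Lemma pair_op_nilpotent v : S v -> iter (n.+1).*2 (pair_op true) v = 0.
Proof.
(* A product of at least 2(n+1) factors A or B contains n+1 equal ones. Here [m] counts the factors
   A - B not yet expanded, [j] and [l] the powers of A and B already split off. *)
move=> Sv; suff H m j l : ((n.+1).*2 <= m + j + l)%N ->
    iter m (pair_op true) (iter j A (iter l B v)) = 0.
  by apply: (H _ 0%N 0%N); rewrite !addn0.
have nil0 (C : {linear V -> V}) i w : (forall v, S v -> iter n.+1 C v = 0) ->
    S w ->
    (n.+1 <= i)%N -> iter i C w = 0.
  move=> C0 Sw /subnK <-; rewrite iterD C0 //.
  by elim: (i - _)%N => //= r ->; rewrite linear0.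
elim: m j l => [|m IH] j l le.
  have [ltl|ltl] := leqP n.+1 l; last first.
    by rewrite (nil0 A) //; [exact: S_iterB | lia].
  by rewrite (nil0 B l) //=; elim: (j) => //= r ->; rewrite linear0.
rewrite iterSr [pair_op _ _]/pair_op.
rewrite -iterS -iter_AB -[B (iter l B v)]iterS.
have iterB x y : iter m (pair_op true) (x - y) =
    iter m (pair_op true) x - iter m (pair_op true) y.
  by elim: (m) => // r IHr; rewrite !iterS IHr linearB.
by rewrite iterB !IH ?subrr //; lia.
Qed.
End OperatorPairs.

Section LinearProp.
Variables (R : pzRingType) (V W : lmodType R) (f : V -> W) (f_lin : linear f).

Lemma linear_prop0 : f 0 = 0.
Proof. by have := f_lin (-1) 0 0; rewrite scaler0 addr0 scaleN1r addNr. Qed.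
Lemma linear_propZ r v : f (r *: v) = r *: f v.
Proof. by have := f_lin r v 0; rewrite linear_prop0 !addr0. Qed.
Lemma linear_propD u v : f (u + v) = f u + f v.
Proof. by have := f_lin 1 u v; rewrite !scale1r. Qed.
Lemma linear_propB u v : f (u - v) = f u - f v.
Proof. by rewrite linear_propD -scaleN1r linear_propZ scaleN1r. Qed.
Lemma linear_prop_sum I (r : seq I) (P : pred I) F :
  f (\sum_(i <- r | P i) F i) = \sum_(i <- r | P i) f (F i).
Proof. exact: (big_morph f linear_propD linear_prop0). Qed.

End LinearProp.

(** * Spaces with q-commuting nilpotent operators, and the twisted operators on their Hom spaces *)

Section QuantumSpaces.
Variables (k : fieldType) (c : nat) (a : 'I_c -> nat) (q : 'M[k]_c).

(** An A-module seen as a vector space with the actions of the generators. The algebra itself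
    returns only when Ext is interpreted. *)
Record qspace := QSpace {
  qcar :> lmodType k;
  qop : 'I_c -> {linear qcar -> qcar};
  qop_nil : forall l v, iter (a l) (qop l) v = 0;
  qop_comm : forall i j v, qop i (qop j v) = q i j *: qop j (qop i v)
}.

Arguments qop {_}.

(** The automorphisms phi_i, kept abstract until a grading provides them. Since q_ii = 1, phi_i
    commutes with x_i. *)
Record twist (N : qspace) := Twist {
  tw : 'I_c -> {linear N -> N};
  twV : 'I_c -> {linear N -> N};
  twK : forall i v, twV i (tw i v) = v;
  twVK : forall i v, tw i (twV i v) = v;
  twC : forall i j v, tw i (tw j v) = tw j (tw i v);
  tw_op : forall i l v, tw i (qop l v) = q l i *: qop l (tw i v)
}.

(** A predicate on bare functions, so that the spaces H_s for all [s] sit in the single k-module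
    [M -> N] on which the operators act. *)
Definition hom (M N : qspace) (s : seq 'I_c) (f : M -> N) : Prop :=
  linear f /\ forall l, l \in s -> forall x, f (qop l x) = qop l (f x).

Lemma hom_sub_closed M N s : sub_closed (@hom M N s).
Proof.
split; first by split=> [r x y|l _ x] /=; rewrite ?linear0 ?scaler0 ?addr0.
move=> f g [fl fX] [gl gX]; have fgE x : (f - g) x = f x - g x by [].
split=> [r x y|l ls x]; rewrite !fgE.
  by rewrite fl gl scalerBr opprD addrACA.
by rewrite fX // gX // linearB.
Qed.

Section HomOperators.
Variables (M N : qspace) (w : twist N).
Implicit Types (f : M -> N).

Definition left_op i f : M -> N := fun x => tw w i (qop i (f x)).
Definition right_op i f : M -> N := fun x => tw w i (f (qop i x)).

Fact left_op_linear i : linear (left_op i).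
Proof. by move=> r f g; apply/funext => x; rewrite /left_op /= !linearP. Qed.
Fact right_op_linear i : linear (right_op i).
Proof. by move=> r f g; apply/funext => x; rewrite /right_op /= !linearP. Qed.
HB.instance Definition _ i :=
  GRing.isLinear.Build k (M -> N) (M -> N) *:%R (left_op i) (left_op_linear i).
HB.instance Definition _ i :=
  GRing.isLinear.Build k (M -> N) (M -> N) *:%R (right_op i)
      (right_op_linear i).

(* For [b = true] this is f |-> phi_i (x_i f - f x_i), for [b = false] it is
   f |-> phi_i^(a_i - 1) (sum_l x_i^l f x_i^(a_i - 1 - l)). *)
Definition hom_op i b : {linear (M -> N) -> (M -> N)} :=
  pair_op (a i).-1 (left_op i) (right_op i) b.

Hypotheses (q_comm : (forall i, q i i = 1) /\ (forall i j, q i j * q j i = 1)).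
Hypothesis a_ge2 : forall i, (2 <= a i)%N.

Let tw_qop i v : tw w i (qop i v) = qop i (tw w i v).
Proof. by rewrite tw_op q_comm.1 scale1r. Qed.

Lemma tw_iter_qop i m n v :
  iter m (tw w i) (iter n (qop i) v) = iter n (qop i) (iter m (tw w i) v).
Proof.
have tw1 r u : iter r (tw w i) (qop i u) = qop i (iter r (tw w i) u).
  by elim: r => //= r ->; rewrite tw_qop.
by elim: n => //= n IH; rewrite tw1 IH.
Qed.

Lemma left_op_iter i m f x :
  iter m (left_op i) f x = iter m (tw w i) (iter m (qop i) (f x)).
Proof.
elim: m => //= m IH; rewrite /left_op IH; congr (tw w i _).
by rewrite -[qop i (iter m (qop i) (f x))]iterS !tw_iter_qop.
Qed.

Lemma right_op_iter i m f x :
  iter m (right_op i) f x = iter m (tw w i) (f (iter m (qop i) x)).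
Proof.
elim: m x => //= m IH x; rewrite /right_op IH; congr (tw w i (iter _ _ (f _))).
by rewrite -iterSr iterS.
Qed.

Lemma left_right_op i f : left_op i (right_op i f) = right_op i (left_op i f).
Proof.
by apply/funext => x; rewrite /left_op /right_op [X in _ =
    tw w i X]tw_op q_comm.1 scale1r.
Qed.

Let iter0 (V : lmodType k) (g : {linear V -> V}) m : iter m g 0 = 0.
Proof. by elim: m => //= m ->; rewrite linear0. Qed.

Let a_gt0 i : (0 < a i)%N. Proof. exact: ltnW (a_ge2 i). Qed.

Lemma left_op_nil i f : iter (a i).-1.+1 (left_op i) f = 0.
Proof.
by apply/funext => x; rewrite left_op_iter prednK ?qop_nil ?iter0.
Qed.

Lemma right_op_nil i f : linear f -> iter (a i).-1.+1 (right_op i) f = 0.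
Proof.
by move=> fl; apply/funext => x;
    rewrite right_op_iter prednK ?qop_nil ?(linear_prop0 fl) ?iter0.
Qed.

(** Moving x_l out past x_i costs q_il and past phi_i costs q_li, and these cancel. The same
    cancellation serves [right_op]. *)
Lemma hom_left_op s i f : i \notin s -> hom s f -> hom s (left_op i f).
Proof.
move=> si [fl fX]; split=> [r x y|l ls x];
    rewrite /left_op ?fl ?linearP // fX //.
by rewrite qop_comm linearZ /= tw_op scalerA q_comm.2 scale1r.
Qed.

Lemma hom_right_op s i f : i \notin s -> hom s f -> hom s (right_op i f).
Proof.
move=> si [fl fX]; split=> [r x y|l ls x];
    rewrite /right_op ?linearP ?fl ?linearP //.
by rewrite qop_comm (linear_propZ fl) linearZ /= fX // tw_op scalerA q_comm.2
    scale1r.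
Qed.

Section Stable.
Variables (s : seq 'I_c) (i : 'I_c).
Hypothesis si : i \notin s.

Lemma hom_hom_op b f : hom s f -> hom s (hom_op i b f).
Proof.
apply: (@pair_op_stable k (M -> N : lmodType k) _ _ _ (@hom M N s)).
- exact: hom_sub_closed.
- by move=> g; exact: hom_left_op.
- by move=> g; exact: hom_right_op.
Qed.

Lemma hom_opK b f : hom s f -> hom_op i b (hom_op i (~~ b) f) = 0.
Proof.
apply: (@pair_opK k (M -> N : lmodType k) _ _ _ (@hom M N s)).
- by move=> g; exact: left_right_op.
- by move=> g _; exact: left_op_nil.
- by move=> g [gl _]; exact: right_op_nil.
Qed.

Lemma hom_op_nilpotent f : hom s f -> iter ((a i).-1.+1).*2 (hom_op i true) f =
    0.
Proof.
apply: (@pair_op_nilpotent k (M -> N : lmodType k) _ _ _ (@hom M N s)).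
- by move=> g; exact: hom_right_op.
- by move=> g; exact: left_right_op.
- by move=> g _; exact: left_op_nil.
- by move=> g [gl _]; exact: right_op_nil.
Qed.

End Stable.

Let qop_tw i j v : qop j (tw w i v) = q i j *: tw w i (qop j v).
Proof. by rewrite tw_op scalerA q_comm.2 scale1r. Qed.

Let swap_ll i j f : left_op j (left_op i f) = q i j *: left_op i (left_op j f).
Proof.
apply/funext => x; rewrite /left_op scalrfctE !qop_tw !linearZ /= twC.
by rewrite scalerA mulrC -scalerA; congr (_ *: _);
    rewrite (qop_comm j i) !linearZ.
Qed.

Let swap_rl i j f : right_op j (left_op i f) =
    q i j *: left_op i (right_op j f).
Proof.
apply/funext => x; rewrite /left_op /right_op scalrfctE !qop_tw !linearZ /= twC.
by rewrite scalerA q_comm.2 scale1r.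
Qed.

Let left_right_op' i j f : left_op j (right_op i f) =
    q i j *: right_op i (left_op j f).
Proof.
by apply/funext => x;
    rewrite /left_op /right_op scalrfctE !qop_tw !linearZ /= twC.
Qed.

Let swap_rr i j f : linear f -> right_op j (right_op i f) =
    q i j *: right_op i (right_op j f).
Proof.
move=> fl; apply/funext => x;
    rewrite /right_op scalrfctE qop_comm (linear_propZ fl).
by rewrite !linearZ /= twC.
Qed.

Let deg i (b : bool) := if b then 1%N else (a i).-1.

(** All four exchanges of [left_op] or [right_op] at j with [left_op] or [right_op] at i involve the
    same scalar q_ij, so homogeneous polynomials in them commute up to a power given by the product
    of the degrees. *)
Lemma hom_op_swap i j b b' f : linear f ->
  hom_op i b (hom_op j b' f) =
      (q j i ^+ deg j b') ^+ deg i b *: hom_op j b' (hom_op i b f).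
Proof.
move=> fl.
have f0 : hom [::] f by [].
have homA l (g : M -> N) : hom [::] g ->
    hom [::] (left_op l g) by exact: hom_left_op.
have homB l (g : M -> N) : hom [::] g ->
    hom [::] (right_op l g) by exact: hom_right_op.
have swap1 (Z : {linear (M -> N) -> (M -> N)}) g l r d : hom [::] g ->
    (forall g, hom [::] g -> left_op l (Z g) = r *: Z (left_op l g)) ->
    (forall g, hom [::] g -> right_op l (Z g) = r *: Z (right_op l g)) ->
    hom_op l d (Z g) = r ^+ deg l d *: Z (hom_op l d g).
  move=> g0 ZA ZB.
  exact: (@pair_op_swap k (M -> N : lmodType k) _ _ _ (@hom M N [::])
    (homA l) (homB l) Z r ZA ZB d g g0).
(* The exchange is read in the opposite direction, which inverts q_ij into q_ji. *)
have swap2 (Z : {linear (M -> N) -> (M -> N)}) g :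
    (Z = left_op i :> (_ -> _) \/ Z = right_op i :> (_ -> _)) -> hom [::] g ->
    Z (hom_op j b' g) = q j i ^+ deg j b' *: hom_op j b' (Z g).
  move=> ZE g0; rewrite (swap1 Z g j (q i j)) //.
    by rewrite scalerA -exprMn q_comm.2 expr1n scale1r.
  - by case: ZE => -> h [hl _]; [exact: swap_ll | exact: left_right_op'].
  - by case: ZE => -> h [hl _]; [exact: swap_rl | exact: swap_rr].
apply: swap1 => // g g0; apply: swap2 => //; [by left | by right].
Qed.

End HomOperators.

End QuantumSpaces.
Arguments qop {k c a q _}.
Arguments hom_op {k c a q M N} w i b.
Arguments left_op {k c a q M N} w i f.
Arguments right_op {k c a q M N} w i f.
Arguments hom {k c a q M N} s f.

(** * Exactness of the operator pairs on maps out of a free module *)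

Section FreeExactness.
Variables (k : fieldType) (c : nat) (a : 'I_c -> nat) (q : 'M[k]_c).
Hypotheses (q_comm : (forall i, q i i = 1) /\ (forall i j, q i j * q j i = 1))
  (a_ge2 : forall i, (2 <= a i)%N).

(* [xcoef m] reads off the coefficient of [x_i^m]. *)
Record splitting (P : qspace a q) (i : 'I_c) := Splitting {
  xcoef : nat -> {linear P -> P};
  xcoef0 : forall x, xcoef 0 (qop i x) = 0;
  xcoefS : forall m x, (m.+1 < a i)%N -> xcoef m.+1 (qop i x) = xcoef m x;
  xcoef_op : forall m l x, l != i ->
    xcoef m (qop l x) = q l i ^+ m *: qop l (xcoef m x);
  xcoef_sum : forall x, x = \sum_(m < a i) iter m (qop i) (xcoef m x)
}.

Variables (P N : qspace a q) (w : twist N) (i : 'I_c) (sp : splitting P i).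
Implicit Type f : P -> N.

Let n := (a i).-1.
Let nE : n.+1 = a i. Proof. by rewrite prednK // ltnW. Qed.

Let XP m : P -> P := iter m (qop i).
Let XN m : N -> N := iter m (qop i).

Let iter_lin (V : lmodType k) (g : {linear V -> V}) m : linear (iter m g).
Proof. exact: iter_linear. Qed.

Lemma hom_op_falseE f x :
  hom_op w i false f x = iter n (tw w i)
      (\sum_(l < n.+1) XN l (f (XP (n - l) x))).
Proof.
rewrite /hom_op /= /pair_op (linear_prop_sum (iter_lin _ _)).
have -> (I : Type) (r : seq I) (F : I -> P -> N) :
    (\sum_(j <- r) F j) x = \sum_(j <- r) F j x.
  by elim/big_rec2: _ => // j y1 y2 _ <-.
apply: eq_bigr => l _; rewrite left_op_iter // right_op_iter //.
rewrite -[iter l (qop i) (iter _ _ _)]tw_iter_qop // -iterD.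
by rewrite (subnKC (leq_ord l)).
Qed.

Let twV_iter m v : iter m (tw w i) (iter m (twV w i) v) = v.
Proof. by elim: m => // m IH; rewrite iterSr [iter m.+1 _ v]iterS twVK. Qed.

Let twV_qop j v : twV w i (qop j v) = q i j *: qop j (twV w i v).
Proof.
rewrite -{1}[v](twVK w i) -[qop j _]scale1r -(q_comm.2 i j) -scalerA -tw_op.
by rewrite linearZ /= twK.
Qed.

(* Write x = sum_m x_i^m x_m. If D_i f = 0 then f = E_i g for
   g x = phi_i^(1 - a_i) (f x_(a_i - 1)). If E_i f = 0 then f = D_i g for the g
   vanishing on the x_0 with g (x_i y) = x_i (g y) - phi_i^-1 (f y) for
   y = x_i^m x_m, m < a_i - 1. *)
Lemma split_exact s : i \notin s ->
  exact_pair (hom_op w i) (@hom k c a q P N s).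
Proof.
have X_op (Q : qspace a q) r l (y : Q) :
    iter r (qop i) (qop l y) = q i l ^+ r *: qop l (iter r (qop i) y).
  elim: r => [|r IH]; first by rewrite scale1r.
  by rewrite !iterS IH linearZ /= qop_comm scalerA -exprSr.
have xcoef_top m l x : (l + m <= n)%N -> xcoef sp (l + m) (XP m x) =
    xcoef sp l x.
  elim: m => [|m IH] le; first by rewrite addn0.
  by rewrite addnS [XP _ _]iterS xcoefS ?IH //; have := nE; lia.
have twV_XN m l v : iter m (twV w i) (XN l v) = XN l (iter m (twV w i) v).
  have twV1 r u : iter r (twV w i) (qop i u) = qop i (iter r (twV w i) u).
    by elim: r => //= r ->; rewrite twV_qop q_comm.1 scale1r.
  by elim: l => //= l <-; rewrite twV1.
have iVl m : linear (iter m (twV w i)) by exact: iter_lin.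
have twV_op m l v : iter m (twV w i) (qop l v) =
    q i l ^+ m *: qop l (iter m (twV w i) v).
  elim: m => [|m IH]; first by rewrite scale1r.
  by rewrite !iterS IH linearZ /= twV_qop scalerA -exprSr.
move=> si [] f [fl fX] Tf.
  have fXi x : f (qop i x) = qop i (f x).
    move/(congr1 (fun g => g x)) : Tf; rewrite /hom_op /= /left_op /right_op =>
        /eqP.
    by rewrite subr_eq0 => /eqP/(can_inj (twK w i)).
  have fXP m x : f (XP m x) = XN m (f x) by elim: m => //= m IH; rewrite fXi IH.
  exists (fun x => iter n (twV w i) (f (xcoef sp n x))).
    split=> [r x y|l ls x]; first by rewrite linearP fl iVl.
    have li : l != i by apply: contraNneq si => <-.
    (* The coefficient map contributes q_li^n and the inverse twists q_il^n, which cancel. *)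
    rewrite xcoef_op // (linear_propZ fl) fX // (linear_propZ (iVl _)) twV_op.
    by rewrite scalerA -exprMn q_comm.2 expr1n scale1r.
  apply/funext => x; rewrite -[~~ true]/false hom_op_falseE //.
  (* The top coefficient of x_i^(n-l) x is the coefficient of x_i^l in x, so the norm sum becomes f
     applied to the expansion of x. *)
  rewrite (eq_bigr (fun l : 'I_n.+1 =>
      iter n (twV w i) (f (XP l (xcoef sp l x))))) => [|l _]; last first.
    have := @xcoef_top (n - l)%N l x; rewrite (subnKC (leq_ord l)) => ->//.
    by rewrite fXP -twV_XN.
  rewrite -(linear_prop_sum (iVl n)) twV_iter -(linear_prop_sum fl); congr f.
  by rewrite [LHS](xcoef_sum sp) -nE.
have fXN x : \sum_(l < n.+1) XN l (f (XP (n - l) x)) = 0.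
  have := congr1 (fun g => g x) Tf; rewrite hom_op_falseE // => T0.
  have twinj m : injective (iter m (tw w i)).
    by elim: m => //= m IH u v /(can_inj (twK w i)); exact: IH.
  by apply: (twinj n); rewrite T0 (linear_prop0 (iter_lin _ _)).
pose f' x := twV w i (f x).
have f'l : linear f' by move=> r x y; rewrite /f' fl linearP.
have f'XN x : \sum_(l < n.+1) XN l (f' (XP (n - l) x)) = 0.
  rewrite (eq_bigr (fun l : 'I_n.+1 => twV w i (XN l (f (XP (n - l) x))))).
    by rewrite -linear_sum fXN linear0.
  by move=> l _; symmetry; exact: (twV_XN 1%N).
(* The recursion for g unrolled: g (x_i^m x_m) is minus the sum over r < m of x_i^(m-1-r) f' (x_i^r
   x_m), where f' = phi_i^-1 f. *)
exists (fun x => - \sum_(m < a i) \sum_(r < m)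
    XN (m - r.+1) (f' (XP r (xcoef sp m x)))).
  split=> [r x y|l ls x].
    rewrite scalerN -opprD scaler_sumr -big_split; congr (- _).
    apply: eq_bigr => m _; rewrite scaler_sumr -big_split; apply: eq_bigr =>
        t _ /=.
    by rewrite linearP /XP iter_linear f'l /XN iter_linear.
  have li : l != i by apply: contraNneq si => <-.
  rewrite /= linearN; congr (- _); rewrite linear_sum; apply: eq_bigr => m _.
  rewrite linear_sum; apply: eq_bigr => r _; rewrite /= xcoef_op //.
  have Xl (Q : qspace a q) t := iter_lin (@qop _ _ _ _ Q i) t.
  have f'X v : f' (qop l v) =
      q i l *: qop l (f' v) by rewrite /f' fX // twV_qop.
  rewrite /XP /XN (linear_propZ (Xl _ _)) X_op !(linear_propZ f'l) f'X
      !(linear_propZ (Xl _ _)) X_op.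
  rewrite !scalerA -!mulrA -!exprS -exprD.
  (* x_l passes r factors x_i, one phi_i^-1 and m - r - 1 further factors x_i. Altogether this gives
     q_il^m, cancelling the q_li^m of the coefficient map. *)
  have -> : (r + (m - r.+1).+1)%N = m by have := ltn_ord r; lia.
  by rewrite -exprMn q_comm.2 expr1n scale1r.
apply/funext => x; rewrite -[~~ false]/true /hom_op /= -[f](_ : (fun y =>
    tw w i (f' y)) = f); last first.
  by apply/funext => y; rewrite /f' twVK.
transitivity (tw w i (qop i (- \sum_(m < a i) \sum_(r < m) XN (m - r.+1)
    (f' (XP r (xcoef sp m x)))) + \sum_(m < a i) \sum_(r < m)
    XN (m - r.+1) (f' (XP r (xcoef sp m (qop i x)))))); last first.
  have twN v : tw w i (- v) = - tw w i v by exact: linearN.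
  by rewrite linearD; congr (_ + _); rewrite -[LHS]opprK -twN.
congr (tw w i _).
pose G m := \sum_(r < m.+1) XN (m - r) (f' (XP r (xcoef sp m x))).
rewrite -nE [X in _ + X]big_ord_recl big_ord0 add0r.
rewrite (eq_bigr (fun m : 'I_n => G m)); last first.
  move=> m _; apply: eq_bigr => r _; transitivity (XN (m.+1 - r.+1)
      (f' (XP r (xcoef sp m.+1 (qop i x))))); first by [].
  rewrite subSS xcoefS //.
  by have := ltn_ord m; have := nE; lia.
rewrite linearN linear_sum (eq_bigr (fun m : 'I_n.+1 =>
    G m - f' (XP m (xcoef sp m x)))); last first.
  move=> m _; rewrite /G big_ord_recr /= subnn addrK linear_sum.
  by apply: eq_bigr => r _; rewrite /= -[qop i _]iterS -subSn.
rewrite sumrB [in X in - X]big_ord_recr /= opprB.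
(* The other [G m] cancel against the expansion of g (x_i x). The top one has no partner, and it
   vanishes because E_i f = 0. *)
have -> : G n = 0.
  rewrite -[RHS](f'XN (xcoef sp n x)) /G (reindex_inj rev_ord_inj) /=.
  by apply: eq_bigr => l _; rewrite subSS subKn // leq_ord.
rewrite addr0 subrK -(linear_prop_sum f'l); congr f'.
by rewrite [LHS](xcoef_sum sp) -nE.
Qed.

End FreeExactness.

(** * Resolutions *)

Section QuantumResolutions.
Variables (k : fieldType) (c : nat) (a : 'I_c -> nat) (q : 'M[k]_c).
Hypotheses (q_comm : (forall i, q i i = 1) /\ (forall i j, q i j * q j i = 1))
  (a_ge2 : forall i, (2 <= a i)%N).
Variables (M N : qspace a q) (w : twist N).
Variables (P : nat -> qspace a q) (d : forall n, {linear P n.+1 -> P n}).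
Variable e : {linear P 0%N -> M}.
Hypotheses (d_qop : forall n l x, d n (qop l x) = qop l (d n x))
  (e_qop : forall l x, e (qop l x) = qop l (e x))
  (e_surj : forall y, exists x, e x = y)
  (e_exact : forall x, e x = 0 <-> exists y, x = d 0 y)
  (d_exact : forall n x, d n x = 0 <-> exists y, x = d n.+1 y)
  (P_split : forall n i, splitting (P n) i).

Definition precomp_d n (f : P n -> N) : P n.+1 -> N := f \o d n.
Fact precomp_d_zmod_morphism n : zmod_morphism (@precomp_d n).
Proof. by []. Qed.
HB.instance Definition _ n := GRing.isZmodMorphism.Build
  (P n -> N) (P n.+1 -> N) (@precomp_d n) (@precomp_d_zmod_morphism n).

Let V n : zmodType := P n -> N.
Let delta n : {additive V n -> V n.+1} := @precomp_d n.
Let T i n b : {additive V n -> V n} := hom_op w i b.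

Definition hom_acyclic s n := acyclic delta (fun n => @hom k c a q (P n) N s) n.

Let hom_delta s n f : @hom k c a q (P n) N s f -> hom s (delta n f).
Proof.
move=> [fl fX]; split=> [r x y|l ls x] /=; rewrite /precomp_d /=.
  by rewrite linearP fl.
by rewrite d_qop fX.
Qed.

Let deltaT i n b f : delta n (T i n b f) = T i n.+1 b (delta n f).
Proof.
apply/funext => x; case: b.
  change (tw w i (qop i (f (d n x))) - tw w i (f (qop i (d n x))) =
          tw w i (qop i (f (d n x))) - tw w i (f (d n (qop i x)))).
  by rewrite d_qop.
change (hom_op w i false f (d n x) = hom_op w i false (precomp_d f) x).
rewrite !hom_op_falseE //; congr (iter _ _ _).
apply: eq_bigr => l _; congr (iter _ _ (f _)).
by elim: (_ - l)%N => //= m ->; rewrite d_qop.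
Qed.

Lemma hom_op_true0 i (Q : qspace a q) (f : Q -> N) :
  hom_op w i true f = 0 <-> forall x, f (qop i x) = qop i (f x).
Proof.
split=> [Tf x|fX].
  move/(congr1 (fun g => g x)) : Tf; rewrite /hom_op /= /left_op /right_op =>
      /eqP.
  by rewrite subr_eq0 => /eqP/(can_inj (twK w i)).
apply/funext => x.
change (tw w i (qop i (f x)) - tw w i (f (qop i x)) = 0).
by rewrite fX subrr.
Qed.

Lemma hom_cons i s (Q : qspace a q) (f : Q -> N) :
  hom (i :: s) f <-> hom s f /\ hom_op w i true f = 0.
Proof.
split=> [[fl fX]|[[fl fX] /hom_op_true0 fi]].
  split; first by split=> // l ls; apply: fX; rewrite inE ls orbT.
  by apply/hom_op_true0; apply: fX; rewrite inE eqxx.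
by split=> // l; rewrite inE => /predU1P[->|/fX].
Qed.

(** A k-linear cocycle vanishes on the kernel of [d n], hence factors through it: over a field every
    module is injective. *)
Lemma acyclic_nil n : hom_acyclic [::] n.
Proof.
move=> f [fl _] df.
have [|g gl gE] := linear_factor (u := d n) (linearP _) fl.
  by move=> x /d_exact[y ->]; exact: (congr1 (fun h => h y) df).
by exists g => //; apply/funext.
Qed.

Section Step.
Variables (i : 'I_c) (s : seq 'I_c).
Hypothesis si : i \notin s.

Let hom_sub n := @hom_sub_closed k c a q (P n) N s.
Let S_T n b f : @hom k c a q (P n) N s f -> hom s (T i n b f).
Proof. exact: hom_hom_op. Qed.
Let TT n b f : @hom k c a q (P n) N s f -> T i n b (T i n (~~ b) f) = 0.
Proof. exact: hom_opK. Qed.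
Let delta2 n f : @hom k c a q (P n) N s f -> delta n.+1 (delta n f) = 0.
Proof.
move=> [fl _]; apply/funext => x; change (f (d n (d n.+1 x)) = 0).
by rewrite (d_exact _).2 ?(linear_prop0 fl) //; exists x.
Qed.
Let S_exact n : exact_pair (T i n) (@hom k c a q (P n) N s).
Proof. exact: split_exact. Qed.

Let kerTE n (f : V n) : kerT (T i) (fun n => @hom k c a q (P n) N s) true f <->
  hom (i :: s) f.
Proof. by rewrite hom_cons. Qed.

Let acyclic_kerTE n : acyclic delta (kerT (T i) (fun n =>
    @hom k c a q (P n) N s) true) n
  <-> hom_acyclic (i :: s) n.
Proof.
by split=> ac f /kerTE fS df; have [g /kerTE gS ->] := ac f fS df; exists g.
Qed.

(** Left exactness: the degree-0 cocycles are the space H_s(M, N), embedded by composition with the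
    augmentation. *)
Let augE (g : P 0%N -> N) : zero_cocycle delta (fun n =>
    @hom k c a q (P n) N s) g <->
  exists2 f : M -> N, hom s f & g = f \o e.
Proof.
split=> [[[gl gX] dg]|[f [fl fX] ->]]; last first.
  split.
    by split=> [r x y|l ls x] /=; rewrite ?linearP ?fl // e_qop fX.
  apply/funext => x; change (f (e (d 0 x)) = 0).
  by rewrite (e_exact _).2 ?(linear_prop0 fl) //; exists x.
have [|f fl fE] := linear_factor (u := e) (linearP _) gl.
  by move=> x /e_exact[y ->]; exact: (congr1 (fun h => h y) dg).
exists f; last exact/funext.
split=> // l ls y; have [x <-] := e_surj y.
by rewrite -e_qop -!fE gX.
Qed.

Let hom_op_e b (f : M -> N) : hom_op w i b (f \o e) = hom_op w i b f \o e.
Proof.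
apply/funext => x; case: b.
  change (tw w i (qop i (f (e x))) - tw w i (f (e (qop i x))) =
          tw w i (qop i (f (e x))) - tw w i (f (qop i (e x)))).
  by rewrite e_qop.
change (hom_op w i false (f \o e) x = hom_op w i false f (e x)).
rewrite !hom_op_falseE //; congr (iter _ _ _).
apply: eq_bigr => l _; congr (iter _ _ (f _)).
by elim: (_ - l)%N => //= m <-; rewrite e_qop.
Qed.

Let e_inj (f g : M -> N) : f \o e = g \o e -> f = g.
Proof.
move=> fg; apply/funext => y; have [x <-] := e_surj y.
exact: (congr1 (fun h => h x) fg).
Qed.

Let exact0E :
  exact_pair (T i 0%N) (zero_cocycle delta (fun n =>
      @hom k c a q (P n) N s)) <->
  exact_pair (hom_op w i) (@hom k c a q M N s).
Proof.
split=> ex b f.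
  move=> fS Tf; have [||g /augE[h hS ->] gE] := ex b (f \o e).
  - by apply/augE; exists f.
  - by rewrite /T /= [LHS]hom_op_e Tf.
  by exists h => //; apply: e_inj; rewrite gE; exact: hom_op_e.
move=> /augE[h hS ->]; rewrite /T /= [LHS in LHS = _ -> _]hom_op_e => Th.
have [|g gS ->] := ex b h hS.
  by apply: e_inj; rewrite Th.
by exists (g \o e); [apply/augE; exists g | rewrite -hom_op_e].
Qed.

Lemma acyclic_uncons n0 : (forall n, (n0 <= n)%N -> hom_acyclic (i :: s) n) ->
  forall n, (n0 <= n)%N -> hom_acyclic s n.
Proof.
move=> ac; apply: (@acyclic_of_kernel V delta (T i)
  (fun n => @hom k c a q (P n) N s) hom_sub (hom_delta (s :=
      s)) S_T (deltaT i) TT delta2 S_exact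
  n0 ((a i).-1.+1).*2) => //.
- by move=> n f fS; exact: (hom_op_nilpotent w q_comm a_ge2 si fS).
- by move=> n le; apply/acyclic_kerTE; exact: ac.
Qed.

Lemma acyclic_cons : (forall n, hom_acyclic s n) ->
  exact_pair (hom_op w i) (@hom k c a q M N s) -> forall n,
      hom_acyclic (i :: s) n.
Proof.
move=> ac /exact0E ex n; apply/acyclic_kerTE.
exact: (@kernel_acyclic V delta (T i) (fun n => @hom k c a q (P n) N s)
  hom_sub (hom_delta (s := s)) S_T (deltaT i) TT delta2 S_exact ac ex).
Qed.

Lemma exact_of_acyclic_cons n0 : (forall n, hom_acyclic s n) ->
  (forall n, (n0 <= n)%N -> hom_acyclic (i :: s) n) ->
  exact_pair (hom_op w i) (@hom k c a q M N s).
Proof.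
move=> ac acK; apply/exact0E.
apply: (@exact_zero_cocycles V delta (T i) (fun n => @hom k c a q (P n) N s)
  hom_sub (hom_delta (s := s)) S_T (deltaT i) TT delta2 S_exact n0) => //.
by move=> n le; apply/acyclic_kerTE; exact: acK.
Qed.

End Step.

(** All indices but i are peeled off, preserving vanishing in large degrees; the remaining case adds
    i to the acyclic case of the empty list. *)
Lemma exact_of_acyclic n0 :
  (forall n, (n0 <= n)%N -> hom_acyclic (enum 'I_c) n) ->
  forall i, exact_pair (hom_op w i) (@hom k c a q M N [::]).
Proof.
move=> ac i.
have mem_eq s t : s =i t -> forall n, hom_acyclic s n -> hom_acyclic t n.
  move=> st n acs f [fl fX] df; have [|g [gl gX] ->] := acs f _ df.
    by split=> // l; rewrite st; exact: fX.
  by exists g => //; split=> // l; rewrite -st; exact: gX.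
apply: (@exact_of_acyclic_cons i [::] _ n0) => //; first exact: acyclic_nil.
suff H s t : uniq (s ++ t) -> (forall n, (n0 <= n)%N ->
    hom_acyclic (s ++ t) n) ->
    forall n, (n0 <= n)%N -> hom_acyclic t n.
  (* Only membership in the list matters, so i may be moved to the end. *)
  apply: (H (rem i (enum 'I_c)) [:: i]) => [|n le].
    rewrite cats1 rcons_uniq rem_uniq ?enum_uniq // andbT.
    by rewrite mem_rem_uniqF ?enum_uniq.
  apply: mem_eq (ac n le) => j; rewrite mem_enum mem_cat inE.
  by rewrite mem_rem_uniq ?enum_uniq // !inE mem_enum andbT orNb.
elim: s => //= j s IH /andP[js us] acst.
exact: (IH us (acyclic_uncons js acst)).
Qed.

Lemma acyclic_of_exact :
  (forall i s, i \notin s -> exact_pair (hom_op w i) (@hom k c a q M N s)) ->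
  forall n, hom_acyclic (enum 'I_c) n.
Proof.
move=> ex; elim: (enum 'I_c) (enum_uniq 'I_c) => [_|i s IH /= /andP[si us]].
  exact: acyclic_nil.
by apply: acyclic_cons => //; [exact: IH | exact: ex].
Qed.

End QuantumResolutions.

(** * Gradings *)

Section GradedSpaces.
Variables (k : fieldType) (c : nat) (a : 'I_c -> nat) (q : 'M[k]_c).
Hypotheses (q_comm : (forall i, q i i = 1) /\ (forall i j, q i j * q j i = 1))
  (a_ge2 : forall i, (2 <= a i)%N).

Local Notation "'e_ l" := (delta_mx 0 l : 'rV[int]_c) (at level 8,
    l at level 2).

(** The grading as a finite family of projections, so that the twists and the degree parts of maps
    are finite sums of linear operators. *)
Record graded_space (N : qspace a q) := GradedSpace {
  gpart : 'rV[int]_c -> {linear N -> N};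
  gsupp : seq 'rV[int]_c;
  gsupp_uniq : uniq gsupp;
  gpart_gpart : forall d e v, gpart d (gpart e v) =
      if d == e then gpart d v else 0;
  gpart_out : forall d v, d \notin gsupp -> gpart d v = 0;
  gpart_sum : forall v, v = \sum_(d <- gsupp) gpart d v;
  gpart_op : forall d l v, gpart (d + 'e_l) (qop l v) = qop l (gpart d v)
}.

Section Twist.
Variables (N : qspace a q) (g : graded_space N).

Lemma gpart_ext u v : (forall d, gpart g d u = gpart g d v) -> u = v.
Proof. by move=> uv; rewrite (gpart_sum g u) (gpart_sum g v);
    apply: eq_bigr. Qed.

Lemma gpart_qop d l v : gpart g d (qop l v) = qop l (gpart g (d - 'e_l) v).
Proof. by rewrite -gpart_op subrK. Qed.

Definition gscale (x : 'rV[int]_c -> k) (v : N) : N :=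
  \sum_(d <- gsupp g) x d *: gpart g d v.

Fact gscale_linear x : linear (gscale x).
Proof.
move=> r u v; rewrite /gscale scaler_sumr -big_split; apply: eq_bigr => d _ /=.
by rewrite linearP scalerDr scalerA mulrC -scalerA.
Qed.
HB.instance Definition _ x :=
  GRing.isLinear.Build k N N *:%R (gscale x) (gscale_linear x).

Lemma gpart_gscale x d v : gpart g d (gscale x v) = x d *: gpart g d v.
Proof.
rewrite /gscale linear_sum /=; have [ds|ds] := boolP (d \in gsupp g).
  rewrite (bigD1_seq d) ?gsupp_uniq //= big1 ?addr0 => [|e ed].
    by rewrite linearZ /= gpart_gpart eqxx.
  by rewrite linearZ /= gpart_gpart eq_sym (negPf ed) scaler0.
by rewrite gpart_out // scaler0 big1 // => e _; rewrite gpart_out.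
Qed.

(** The eigenvalue of phi_i on degree d. Since x_l raises d by the l-th unit vector, it multiplies
    this eigenvalue by q_li, which is the required commutation rule. *)
Definition character (i : 'I_c) (d : 'rV[int]_c) : k := \prod_l q l i ^ d 0 l.

Let q_neq0 i j : q i j != 0.
Proof.
by apply: contra_eqN (q_comm.2 i j) => /eqP ->; rewrite mul0r eq_sym oner_eq0.
Qed.

Lemma character_neq0 i d : character i d != 0.
Proof. by apply/prodf_neq0 => l _; rewrite expfz_neq0. Qed.

Lemma character_op i l d : character i (d + 'e_l) = q l i * character i d.
Proof.
rewrite /character (bigD1 l) //= [in RHS](bigD1 l) //= !mxE !eqxx mulrA.
rewrite expfzDr // expr1z [_ * q l i]mulrC; congr (_ * _).
by apply: eq_bigr => m ml; rewrite !mxE eqxx (negPf ml) addr0.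
Qed.

Definition graded_twist : twist N.
Proof.
refine (@Twist k c a q N (fun i => gscale (character i))
  (fun i => gscale (fun d => (character i d)^-1)) _ _ _ _).
- move=> i v; apply: gpart_ext => d.
  by rewrite !gpart_gscale scalerA mulVf ?scale1r ?character_neq0.
- move=> i v; apply: gpart_ext => d.
  by rewrite !gpart_gscale scalerA mulfV ?scale1r ?character_neq0.
- by move=> i j v; apply: gpart_ext => d; rewrite !gpart_gscale !scalerA mulrC.
- move=> i l v; apply: gpart_ext => d;
    rewrite gpart_gscale linearZ /= !gpart_qop.
  rewrite gpart_gscale linearZ /= scalerA; congr (_ *: _).
  by rewrite -character_op subrK.
Defined.

Lemma gpart_tw i d v : gpart g d (tw graded_twist i v) =
    character i d *: gpart g d v.
Proof. exact: gpart_gscale. Qed.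

End Twist.
Section HomGrading.
Variables (M N : qspace a q) (gM : graded_space M) (gN : graded_space N).
Variable j : 'I_c.
Let w := graded_twist gN.
Implicit Type f : M -> N.

(** Only the j-th coordinate of the degree is recorded: the operators for j then raise it, and those
    for any other index preserve it. *)
Definition hom_part (e : int) f : M -> N := fun x =>
  \sum_(d <- gsupp gM) \sum_(d' <- gsupp gN | d' 0 j - d 0 j == e)
    gpart gN d' (f (gpart gM d x)).

Fact hom_part_zmod_morphism e : zmod_morphism (hom_part e).
Proof.
move=> f g; apply/funext => x.
change (hom_part e (f - g) x = hom_part e f x - hom_part e g x).
rewrite /hom_part -sumrB; apply: eq_bigr => d _; rewrite -sumrB;
    apply: eq_bigr => d' _.
exact: linearB.
Qed.
HB.instance Definition _ e :=
  GRing.isZmodMorphism.Build (M -> N) (M -> N) (hom_part e)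
      (hom_part_zmod_morphism e).

Lemma hom_part_linear e f : linear f -> linear (hom_part e f).
Proof.
move=> fl r x y; rewrite /hom_part scaler_sumr -big_split; apply: eq_bigr =>
    d _ /=.
rewrite scaler_sumr -big_split; apply: eq_bigr => d' _ /=.
by rewrite linearP fl linearP.
Qed.

Lemma gpart_hom_part e f d d' x : linear f ->
  gpart gN d' (hom_part e f (gpart gM d x)) =
  if d' 0 j - d 0 j == e then gpart gN d' (f (gpart gM d x)) else 0.
Proof.
move=> fl; have [dM|dM] := boolP (d \in gsupp gM); last first.
  by rewrite (gpart_out _ dM) (linear_prop0 (hom_part_linear e fl))
      (linear_prop0 fl) linear0 if_same.
have [dN|dN] := boolP (d' \in gsupp gN);
    last by rewrite !(gpart_out _ dN) if_same.
rewrite /hom_part (bigD1_seq d) ?gsupp_uniq //= [X in _ + X]big1 ?addr0 =>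
    [|t td]; last first.
  by apply: big1 => t' _; rewrite gpart_gpart (negPf td)
      (linear_prop0 fl) linear0.
rewrite gpart_gpart eqxx linear_sum /= big_mkcond /=.
rewrite (bigD1_seq d') ?gsupp_uniq //= big1 ?addr0 => [|t' td].
  by case: ifP; rewrite ?gpart_gpart ?eqxx.
by case: ifP => // _; rewrite gpart_gpart eq_sym (negPf td).
Qed.

Lemma hom_ext f g : linear f -> linear g ->
  (forall d d' x, gpart gN d' (f (gpart gM d x)) =
      gpart gN d' (g (gpart gM d x))) -> f = g.
Proof.
move=> fl gl fg; apply/funext => x; rewrite (gpart_sum gM x)
    (linear_prop_sum fl) (linear_prop_sum gl).
by apply: eq_bigr => d _; exact: gpart_ext.
Qed.

Lemma hom_part_idem e f : linear f -> hom_part e (hom_part e f) = hom_part e f.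
Proof.
move=> fl; apply: hom_ext => [||d d' x]; try by do !apply: hom_part_linear.
by rewrite !gpart_hom_part //; [case: eqP | exact: hom_part_linear].
Qed.

Let left_op_lin l f : linear f -> linear (left_op w l f).
Proof. by move=> fl r x y; rewrite /left_op fl !linearP. Qed.
Let right_op_lin l f : linear f -> linear (right_op w l f).
Proof. by move=> fl r x y; rewrite /right_op !linearP fl linearP. Qed.

Lemma left_op_hom_part l e f : linear f ->
  left_op w l (hom_part e f) = hom_part (e + (l == j)%:R) (left_op w l f).
Proof.
move=> fl; apply: hom_ext => [||d d' x];
    try by do ![apply: hom_part_linear|apply: left_op_lin].
rewrite gpart_hom_part; last exact: left_op_lin.
rewrite /left_op !gpart_tw !gpart_qop gpart_hom_part // !mxE eqxx /= [j ==
    l]eq_sym.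
rewrite addrAC subr_eq; case: ifP => //; by rewrite linear0 scaler0.
Qed.

Lemma right_op_hom_part l e f : linear f ->
  right_op w l (hom_part e f) = hom_part (e + (l == j)%:R) (right_op w l f).
Proof.
move=> fl; apply: hom_ext => [||d d' x];
    try by do ![apply: hom_part_linear|apply: right_op_lin].
rewrite gpart_hom_part; last exact: right_op_lin.
rewrite /right_op !gpart_tw -gpart_op gpart_hom_part // !mxE eqxx /= [j ==
    l]eq_sym.
by rewrite opprD addrA subr_eq; case: ifP => //; rewrite scaler0.
Qed.

Lemma hom_hom_part s e f : hom s f -> hom s (hom_part e f).
Proof.
move=> [fl fX]; have pl := hom_part_linear e fl; split=> // l ls x.
suff: hom_part e f \o qop l = qop l \o hom_part e f by move/(congr1 (fun h =>
    h x)).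
apply: hom_ext => [r u v|r u v|d d' u] /=; rewrite ?linearP ?pl ?linearP //.
rewrite -gpart_op gpart_hom_part // gpart_op fX // !gpart_qop gpart_hom_part //
    !mxE eqxx /=.
by rewrite opprD addrA addrAC; case: ifP; rewrite ?linear0.
Qed.

Let bound : nat :=
  (\sum_(d <- gsupp gM) `|d 0%R j|%N + \sum_(d <- gsupp gN) `|d 0%R j|%N)%N.

Let bound_le d d' : d \in gsupp gM -> d' \in gsupp gN ->
  - bound%:Z <= d' 0 j - d 0 j <= bound%:Z.
Proof.
move=> dM dN.
have le (s : seq 'rV[int]_c) t : t \in s ->
    (`|t 0%R j| <= \sum_(u <- s) `|u 0%R j|)%N.
  by move=> ts; rewrite (big_rem t ts) /= leq_addr.
have := le _ _ dM; have := le _ _ dN; rewrite /bound.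
set X := (\sum_(u <- gsupp gM) _)%N; set Y := (\sum_(u <- gsupp gN) _)%N; lia.
Qed.

Let hom_part_low e f : e < - bound%:Z -> hom_part e f = 0.
Proof.
move=> lte; apply/funext => x; apply: big1_seq => d /andP[_ dM].
rewrite big_seq_cond; apply: big1 => d' /andP[dN /eqP eE].
by have := bound_le dM dN; rewrite eE; lia.
Qed.

Let hom_part_sum f : linear f -> f =
    \sum_(i < bound.*2.+1) hom_part (i%:Z - bound%:Z) f.
Proof.
move=> fl.
have sumE x : (\sum_(i < bound.*2.+1) hom_part (i%:Z - bound%:Z) f) x =
    \sum_(i < bound.*2.+1) hom_part (i%:Z - bound%:Z) f x.
  by elim/big_rec2: _ => // j' y1 y2 _ <-.
apply: hom_ext => // [r x y|d d' x].
  rewrite !sumE scaler_sumr -big_split; apply: eq_bigr => i _ /=.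
  exact: hom_part_linear.
have [dM|dM] := boolP (d \in gsupp gM); last first.
  rewrite (gpart_out _ dM) (linear_prop0 fl) sumE big1 ?linear0 // => i _.
  by rewrite (linear_prop0 (hom_part_linear _ fl)).
have [dN|dN] := boolP (d' \in gsupp gN); last by rewrite !(gpart_out _ dN).
have b := bound_le dM dN.
have lt : (`|(d' 0 j - d 0 j + bound%:Z)%R|%N < bound.*2.+1)%N.
  by move: b; move: (bound) (d' 0 j - d 0 j) => B z; lia.
rewrite sumE linear_sum (bigD1 (Ordinal lt)) //= big1 ?addr0 => [|i iE].
  rewrite gpart_hom_part // ifT //= gez0_abs ?addrK //.
  by move: b; move: (bound) (d' 0 j - d 0 j) => B z; lia.
rewrite gpart_hom_part // ifN //; apply: contra iE => /eqP iE;
    apply/eqP/val_inj => /=.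
by rewrite iE subrK.
Qed.

(** Adding j to [s] means passing to the kernel of D_j, and the x_j-grading of maps is bounded since
    both modules have finite support. *)
Lemma hom_exact_cons i s : i != j -> i \notin s -> j \notin s ->
  exact_pair (hom_op w i) (@hom k c a q M N s) ->
  exact_pair (hom_op w j) (@hom k c a q M N s) ->
  exact_pair (hom_op w i) (@hom k c a q M N (j :: s)).
Proof.
move=> ij si sj exi exj.
(* The x_j-degrees of D_j and E_j; both are positive because a_j is at least 2. *)
pose t (b : bool) : int := if b then 1 else (a j).-1%:Z.
have iter_hom_part l (C : (M -> N) -> (M -> N)) m e f :
    (forall g, linear g -> linear (C g)) ->
    (forall g e, linear g -> C (hom_part e g) = hom_part (e + (l == j)%:R)
        (C g)) ->
    linear f -> iter m C (hom_part e f) = hom_part (e + (l == j)%:R *+ m)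
        (iter m C f).
  move=> Cl CE fl; elim: m => [|m IH]; first by rewrite addr0.
  rewrite !iterS IH CE -?addrA -?mulrSr //.
  by elim: (m) => //= r IHr; exact: Cl.
have hom_op_hom_part l b e f : hom s f ->
    hom_op w l b (hom_part e f) = hom_part (e + (if l == j then t b else 0))
        (hom_op w l b f).
  move=> [fl _]; have -> : (if l == j then t b else 0) =
      (l == j)%:R *+ (if b then 1 else (a l).-1)%N.
    by rewrite /t; case: eqP => [->|_]; case: b; rewrite ?mul0rn ?natz.
  case: b; rewrite /hom_op /= /pair_op.
    by rewrite left_op_hom_part // right_op_hom_part // raddfB.
  rewrite raddf_sum; apply: eq_bigr => m _.
  have nl : linear (iter ((a l).-1 - m) (right_op w l) f).
    by elim: (_ - m)%N => //= r IHr; exact: right_op_lin.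
  rewrite (iter_hom_part l) //; last first.
  - by move=> *; exact: right_op_hom_part.
  - exact: right_op_lin.
  rewrite (iter_hom_part l) //; first last.
  - by move=> *; exact: left_op_hom_part.
  - exact: left_op_lin.
  by rewrite -addrA -mulrnDr subnK // leq_ord.
have swap0 l m b b' (h : M -> N) : hom s h -> hom_op w l b (hom_op w m b' h) =
    0 ->
    hom_op w m b' (hom_op w l b h) = 0.
  by move=> [hl _] h0; rewrite hom_op_swap // h0 scaler0.
have ex : exact_pair (hom_op w i) (fun f => hom s f /\ hom_op w j true f = 0).
  apply: (@graded_kernel_exact (M -> N : zmodType) (@hom k c a q M N s)
    (fun b => hom_op w j b) (fun b => hom_op w i b) (fun e =>
        @hom_part e) t bound bound.*2.+1).
  - exact: hom_sub_closed.
  - by move=> b f; exact: hom_hom_op.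
  - by move=> b f; exact: hom_hom_op.
  - by move=> e f; exact: hom_hom_part.
  - by move=> b f fS; exact: (hom_opK w q_comm a_ge2 j b fS).
  - by move=> b f fS; exact: (hom_opK w q_comm a_ge2 i b fS).
  - exact: exj.
  - exact: exi.
  - by move=> b b' f fS; exact: swap0.
  - move=> b b' f fS; have fl := fS.1.
    (* The scalar of [hom_op_swap]; multiplying [f] by it turns commutation up to a scalar into the
       required exchange. *)
    pose r := (q i j ^+ (if b' then 1 else (a i).-1)%N) ^+ (if b then 1 else (a
        j).-1)%N.
    have Z l d (h : M -> N) : hom_op w l d (r *: h) =
        r *: hom_op w l d h by exact: linearZ.
    exists (r *: f); last first.
      transitivity (hom_op w i b' (hom_op w j b (r *: f))); last by [].
      by rewrite [LHS]hom_op_swap // !Z.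
    split=> [x u v|l ls u]; rewrite scalrfctE ?fl;
        last by rewrite fS.2 // linearZ.
    by rewrite scalerDr !scalerA mulrC.
  - by case=> //; rewrite /t; have := a_ge2 j; lia.
  - exact: hom_part_low.
  - by move=> f [fl _]; exact: hom_part_sum.
  - by move=> e f [fl _]; exact: hom_part_idem.
  - by move=> b e f fS; rewrite [LHS]hom_op_hom_part ?eqxx.
  - by move=> b e f fS; rewrite [LHS]hom_op_hom_part // (negPf ij) addr0.
move=> b f /(hom_cons w)[fS Tf] Uf.
have [g gS ->] := ex b f (conj fS Tf) Uf.
by exists g => //; apply/(hom_cons w).
Qed.

End HomGrading.

Lemma hom_exact_all (M N : qspace a q) (gM : graded_space M)
    (gN : graded_space N) :
  (forall i, exact_pair (hom_op (graded_twist gN) i) (@hom k c a q M N [::])) ->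
  forall i s, i \notin s ->
    exact_pair (hom_op (graded_twist gN) i) (@hom k c a q M N s).
Proof.
move=> ex i s; elim: s i => [|j s IH] i; first by move=> _; exact: ex.
rewrite inE negb_or => /andP[ij si].
have [sj|sj] := boolP (j \in s); last by apply: hom_exact_cons => //; exact: IH.
have homE (f : M -> N) : hom (j :: s) f <-> hom s f.
  split=> -[fl fX]; split=> // l ls; apply: fX; first by rewrite inE ls orbT.
  by move: ls; rewrite inE => /predU1P[->|].
move=> b f /homE fS Tf; have [g gS ->] := IH i si b f fS Tf.
by exists g => //; apply/homE.
Qed.

End GradedSpaces.

(** * Trace duality *)

Section MatrixDuality.
Variables (k : fieldType).

(** The row space of Q^T lies in ker P^T, and equality follows by counting: dim ker P^T = r - rank P
    = dim ker P is at most rank Q. *)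
Lemma kernel_sub_image_tr r (P Q : 'M[k]_r) : P *m Q = 0 ->
  (forall v : 'rV_r, v *m P = 0 -> exists w, v = w *m Q) ->
  forall v : 'rV_r, v *m P^T = 0 -> exists w, v = w *m Q^T.
Proof.
move=> PQ ex v vP.
have kerQ : (kermx P <= Q)%MS.
  apply/row_subP => i; have [|w ->] := ex (row i (kermx P));
      last exact: submxMl.
  by apply/sub_kermxP; exact: row_sub.
have Qker : (Q^T <= kermx P^T)%MS by apply/sub_kermxP;
    rewrite -trmx_mul PQ trmx0.
have kerQT : (kermx P^T <= Q^T)%MS.
  rewrite -(mxrank_leqif_sup Qker) eqn_leq mxrankS //=.
  by rewrite mxrank_ker !mxrank_tr -mxrank_ker mxrankS.
by apply/submxP; apply: submx_trans kerQT; exact/sub_kermxP.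
Qed.

Variables (n m p : nat).

(** The untwisted D_i and E_i in coordinates. Matrices act on row vectors, so x_i after f is right
    multiplication by [Y], and f after x_i is left multiplication by [X]. *)
Definition mx_op (m' p' : nat) (X : 'M[k]_m') (Y : 'M[k]_p') b
    : {linear 'M[k]_(m', p') -> 'M[k]_(m', p')} :=
  pair_op n (mulmxr Y) (mulmx X) b.

Variables (X : 'M[k]_m) (Y : 'M[k]_p).
Hypotheses (X_nil : forall p' (F : 'M[k]_(m, p')), iter n.+1 (mulmx X) F = 0)
  (Y_nil : forall m' (F : 'M[k]_(m', p)), iter n.+1 (mulmxr Y) F = 0).

Lemma mx_opK b (F : 'M[k]_(m, p)) : mx_op X Y b (mx_op X Y (~~ b) F) = 0.
Proof.
apply: (@pair_opK k _ n _ _ (fun=> True)) => //.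
- by move=> G /=; rewrite mulmxA.
- by move=> G _; exact: Y_nil.
- by move=> G _; exact: X_nil.
Qed.

(** Cyclicity of the trace turns FY - XF into YG - GX, whence the sign for [b = true]; the norm sum
    is preserved after reversing the order of summation. *)
Lemma tr_mx_op b F G :
  \tr (mx_op X Y b F *m G) = (-1) ^+ b * \tr (F *m mx_op Y X b G).
Proof.
case: b; rewrite /mx_op /pair_op /=.
  rewrite mulmxBl mulmxBr !linearB /= mulN1r opprB !mulmxA; congr (_ - _).
  by rewrite -[X *m F *m G]mulmxA [LHS]mxtrace_mulC.
rewrite mul1r mulmx_suml mulmx_sumr !linear_sum (reindex_inj rev_ord_inj) /=.
apply: eq_bigr => l _; rewrite subSS (subKn (leq_ord l)).
have trY j F' G' : \tr (iter j (mulmxr Y) F' *m G') =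
    \tr (F' *m iter j (mulmx Y) G').
  elim: j F' G' => //= j IH F' G'.
  by rewrite -mulmxA IH -iterSr.
have trX j F' G' : \tr (iter j (mulmx X) F' *m G') =
    \tr (F' *m iter j (mulmxr X) G').
  elim: j F' G' => //= j IH F' G'.
  by rewrite -[LHS](congr1 _ (mulmxA _ _ _)) [LHS]mxtrace_mulC -mulmxA IH
      -iterSr.
by rewrite trY trX.
Qed.

(** Presents the trace form as a dot product, so that an adjoint for it becomes a transposed
    matrix. *)
Lemma tr_mxvec (F : 'M[k]_(m, p)) (G : 'M[k]_(p, m)) :
  \tr (F *m G) = (mxvec F *m (mxvec G^T)^T) 0 0.
Proof.
rewrite !mxE (reindex _ (curry_mxvec_bij _ _)) /=.
rewrite /mxtrace (eq_bigr (fun i => \sum_j F i j * G j i)) => [|i _];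
    last by rewrite mxE.
rewrite pair_bigA; apply: eq_bigr => -[i j] _ /=.
by rewrite mxE !mxvecE mxE.
Qed.

Lemma mx_op_dual : exact_pair (mx_op X Y) (fun=> True) ->
  exact_pair (mx_op Y X) (fun=> True).
Proof.
move=> ex.
pose T b := lin_mx (mx_op X Y b).
have TE b F : mxvec F *m T b = mxvec (mx_op X Y b F) by rewrite mul_vec_lin.
have TTE b G : mxvec G^T *m (T b)^T = (-1) ^+ b *: mxvec (mx_op Y X b G)^T.
  apply: (can_inj (@trmxK _ _ _)); rewrite trmx_mul trmxK.
  apply/row_matrixP => i; rewrite !rowE.
  set u := delta_mx 0 i; rewrite -[u]vec_mxK; move: (vec_mx u) => F.
  rewrite mulmxA TE linearZ /= -scalemxAr; apply/rowP => j;
      rewrite ord1 [RHS]mxE.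
  by rewrite -!tr_mxvec tr_mx_op.
have TT b : T b *m T (~~ b) = 0.
  apply/row_matrixP => i; rewrite rowE row0 mulmxA.
  set u := delta_mx 0 i; rewrite -[u]vec_mxK TE TE -{2}[b]negbK mx_opK.
  by rewrite linear0.
move=> b G _ TG; have [||w wE] := @kernel_sub_image_tr _ (T b) (T (~~ b))
    (TT b) _ (mxvec G^T).
- move=> v; rewrite -[v]vec_mxK TE => /(canRL (@mxvecK _ _ _));
    rewrite linear0 => Tv.
  by have [g _ ->] := ex b _ I Tv; exists (mxvec g); rewrite TE.
- by rewrite TTE TG trmx0 linear0 scaler0.
pose W := (vec_mx w)^T; have wW : w = mxvec W^T by rewrite trmxK vec_mxK.
(* The factor absorbs the sign by which the adjoint of [T (~~ b)] differs from
   [mx_op Y X (~~ b)]. *)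
exists ((-1) ^+ (~~ b) *: W) => //.
apply: (can_inj (@trmxK _ _ _)); apply: (can_inj mxvecK).
rewrite wE wW TTE [mx_op _ _ _ (_ *: _)]linearZ /= [(_ *: _)^T]linearZ /=.
by rewrite [RHS]linearZ.
Qed.

End MatrixDuality.

Record coordinates (k : fieldType) (V : lmodType k) := Coordinates {
  cdim : nat;
  ofrow : {linear 'rV[k]_cdim -> V};
  torow : {linear V -> 'rV[k]_cdim};
  ofrowK : cancel ofrow torow;
  torowK : cancel torow ofrow
}.

Section HomDuality.
Variables (k : fieldType) (c : nat) (a : 'I_c -> nat) (q : 'M[k]_c).
Hypotheses (q_comm : (forall i, q i i = 1) /\ (forall i j, q i j * q j i = 1))
  (a_ge2 : forall i, (2 <= a i)%N).
Variable i : 'I_c.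
Let n := (a i).-1.
Let nE : n.+1 = a i. Proof. by rewrite prednK // ltnW. Qed.

Section Matrices.
Variables (V W : lmodType k) (cV : coordinates V) (cW : coordinates W).

Definition hom_mx (f : V -> W) : 'M[k]_(cdim cV, cdim cW) :=
  \matrix_j torow cW (f (ofrow cV (delta_mx 0 j))).
Definition mx_hom (F : 'M[k]_(cdim cV, cdim cW)) : V -> W :=
  fun x => ofrow cW (torow cV x *m F).

Lemma mul_hom_mx f v : linear f -> v *m hom_mx f = torow cW (f (ofrow cV v)).
Proof.
move=> fl; rewrite {2}[v]row_sum_delta linear_sum (linear_prop_sum fl)
    linear_sum.
rewrite mulmx_sum_row; apply: eq_bigr => j _ /=.
by rewrite linearZ (linear_propZ fl) linearZ rowK.
Qed.

Lemma hom_mxK f : linear f -> mx_hom (hom_mx f) = f.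
Proof.
by move=> fl; apply/funext => x; rewrite /mx_hom mul_hom_mx // !torowK.
Qed.

Lemma mx_homK F : hom_mx (mx_hom F) = F.
Proof.
by apply/row_matrixP => j; rewrite rowK /mx_hom !ofrowK rowE.
Qed.

Lemma mx_hom_linear F : linear (mx_hom F).
Proof.
by move=> r x y; rewrite /mx_hom linearP mulmxDl -scalemxAl linearP.
Qed.

End Matrices.

Definition qop_mx (M : qspace a q) (cM : coordinates M) := hom_mx cM cM (qop i).

Section Untwisting.
Variables (M N : qspace a q) (cM : coordinates M) (cN : coordinates N).
Variable w : twist N.
Let X := qop_mx cM.
Let Y := qop_mx cN.

Definition untwisted_hop b (f : M -> N) : M -> N := fun x =>
  if b then qop i (f x) - f (qop i x)
  else \sum_(l < n.+1) iter l (qop i) (f (iter (n - l) (qop i) x)).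

Let deg (b : bool) := if b then 1%N else n.

Let hom_op_untwist b f x :
  hom_op w i b f x = iter (deg b) (tw w i) (untwisted_hop b f x).
Proof.
case: b; last exact: hom_op_falseE.
change (tw w i (qop i (f x)) - tw w i (f (qop i x)) =
        tw w i (qop i (f x) - f (qop i x))).
by rewrite linearB.
Qed.

Let qop_mxE (Q : qspace a q) (cQ : coordinates Q) v :
  ofrow cQ (v *m qop_mx cQ) = qop i (ofrow cQ v).
Proof. by rewrite mul_hom_mx ?torowK //; exact: linearP. Qed.

Lemma mx_hom_op b F :
  mx_hom (mx_op n X Y b F) = untwisted_hop b (mx_hom F).
Proof.
apply/funext => x.
have hY G y : mx_hom (G *m Y) y = qop i (mx_hom G y).
  by rewrite /mx_hom mulmxA qop_mxE.
have hX G y : mx_hom (X *m G) y = mx_hom G (qop i y).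
  by rewrite /mx_hom mulmxA mul_hom_mx ?torowK //; exact: linearP.
case: b; rewrite /mx_op /pair_op /untwisted_hop /=.
  by rewrite /mx_hom mulmxBr linearB; congr (_ - _); [exact: hY | exact: hX].
rewrite {1}/mx_hom mulmx_sumr linear_sum; apply: eq_bigr => l _ /=.
change (mx_hom (iter l (mulmxr Y) (iter (n - l) (mulmx X) F)) x =
  iter l (qop i) (mx_hom F (iter (n - l) (qop i) x))).
have -> j G : mx_hom (iter j (mulmxr Y) G) x = iter j (qop i) (mx_hom G x).
  by elim: j => //= j <-; rewrite hY.
congr (iter l _ _); elim: (n - l)%N x => //= j IH x.
by rewrite hX IH -iterSr.
Qed.

Let twV_iter m v : iter m (tw w i) (iter m (twV w i) v) = v.
Proof. by elim: m => // m IH; rewrite iterSr [iter m.+1 _ v]iterS twVK. Qed.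
Let twK_iter m v : iter m (twV w i) (iter m (tw w i) v) = v.
Proof. by elim: m => // m IH; rewrite iterSr [iter m.+1 _ v]iterS twK. Qed.

Let twV_qop v : twV w i (qop i v) = qop i (twV w i v).
Proof.
rewrite -{1}[v](twVK w i) -[qop i (tw _ _ _)]scale1r -(q_comm.1 i) -tw_op.
by rewrite twK.
Qed.

Let untwisted_tw m b f (g : {linear N -> N}) : (forall v, g (qop i v) =
    qop i (g v)) ->
  untwisted_hop b (fun x => iter m g (f x)) = fun x =>
      iter m g (untwisted_hop b f x).
Proof.
move=> gX; have gl := iter_linear m g.
have gXm j v : iter m g (iter j (qop i) v) = iter j (qop i) (iter m g v).
  have g1 r u : iter r g (qop i u) = qop i (iter r g u) by elim: r => //= r ->.
  by elim: j => //= j <-; rewrite g1.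
apply/funext => x; case: b; rewrite /untwisted_hop.
  by rewrite (linear_propB gl) (gXm 1%N).
by rewrite (linear_prop_sum gl); apply: eq_bigr => l _; rewrite gXm.
Qed.

Let iter_tw_inj m u v : iter m (tw w i) u = iter m (tw w i) v -> u = v.
Proof. by move=> /(congr1 (iter m (twV w i))); rewrite !twK_iter. Qed.

Let tw_qop v : tw w i (qop i v) = qop i (tw w i v).
Proof. by rewrite tw_op q_comm.1 scale1r. Qed.

Let hom_op0 b f : hom_op w i b f = 0 <-> untwisted_hop b f = 0.
Proof.
have tw0 := linear_prop0 (iter_linear (deg b) (tw w i)).
split=> f0; apply/funext => x.
  by apply: (@iter_tw_inj (deg b)); rewrite -hom_op_untwist f0 tw0.
by rewrite hom_op_untwist f0 tw0.
Qed.

(** phi_i is bijective and commutes with x_i, so its powers can be divided out on all k-linear maps.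
    Exactness there does not depend on the twist. *)
Lemma mx_exactP :
  exact_pair (mx_op n X Y) (fun=> True) <-> exact_pair (hom_op w i)
      (@hom k c a q M N [::]).
Proof.
split=> ex b.
  move=> f [fl _] /hom_op0 uf.
  have [||G _ GE] := ex b (hom_mx cM cN f) => //.
    apply: (can_inj (@mx_homK _ _ cM cN)); rewrite mx_hom_op hom_mxK // uf.
    by apply/funext => x; rewrite /mx_hom mulmx0 linear0.
  exists (fun x => iter (deg (~~ b)) (twV w i) (mx_hom G x)).
    by split=> // r x y; rewrite mx_hom_linear iter_linear.
  apply/funext => x; rewrite hom_op_untwist untwisted_tw // twV_iter.
  by rewrite -mx_hom_op -GE hom_mxK.
move=> F _ F0.
pose f x := iter (deg (~~ b)) (tw w i) (mx_hom F x).
have [||g [gl _] gE] := ex b f.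
- by split=> // r x y; rewrite /f mx_hom_linear iter_linear.
- apply/hom_op0; rewrite untwisted_tw // -mx_hom_op F0.
  apply/funext => x; rewrite /mx_hom mulmx0 linear0.
  exact: (linear_prop0 (iter_linear _ _)).
exists (hom_mx cM cN g) => //.
apply: (can_inj (@mx_homK _ _ cM cN)); rewrite mx_hom_op hom_mxK //.
apply/funext => x; apply: (@iter_tw_inj (deg (~~ b))).
by rewrite -hom_op_untwist -gE.
Qed.

End Untwisting.

Lemma qop_mx_nilpotent (Q : qspace a q)
    (cQ : coordinates Q) p (F : 'M_(cdim cQ, p)) :
  iter n.+1 (mulmx (qop_mx cQ)) F = 0.
Proof.
apply/row_matrixP => j; rewrite row0 rowE; move: (delta_mx 0 j) => v.
suff E r u : u *m iter r (mulmx (qop_mx cQ)) F =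
    torow cQ (iter r (qop i) (ofrow cQ u)) *m F.
  by rewrite E nE qop_nil linear0 mul0mx.
elim: r u => [|r IH] u /=; first by rewrite ofrowK.
have -> : u *m (qop_mx cQ *m iter r (mulmx (qop_mx cQ)) F) =
    (u *m qop_mx cQ) *m iter r (mulmx (qop_mx cQ)) F by rewrite mulmxA.
rewrite IH mul_hom_mx; last exact: linearP.
by rewrite torowK -iterSr.
Qed.

Lemma qop_mxr_nilpotent (Q : qspace a q) (cQ : coordinates Q) p (F : 'M_(p,
    cdim cQ)) :
  iter n.+1 (mulmxr (qop_mx cQ)) F = 0.
Proof.
apply/row_matrixP => j; rewrite row0 rowE; move: (delta_mx 0 j) => v.
suff E r : v *m iter r (mulmxr (qop_mx cQ)) F =
    torow cQ (iter r (qop i) (ofrow cQ (v *m F))).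
  by rewrite E nE qop_nil linear0.
elim: r => [|r IH] /=; first by rewrite ofrowK.
by rewrite mulmxA IH mul_hom_mx ?torowK //; exact: linearP.
Qed.

Lemma hom_exact_dual (M N : qspace a q) (cM : coordinates M)
    (cN : coordinates N)
    (wM : twist M) (wN : twist N) :
  exact_pair (hom_op wN i) (@hom k c a q M N [::]) ->
  exact_pair (hom_op wM i) (@hom k c a q N M [::]).
Proof.
move=> /(mx_exactP cM cN) ex; apply/(mx_exactP cN cM).
apply: mx_op_dual ex => p F;
    [exact: qop_mx_nilpotent | exact: qop_mxr_nilpotent].
Qed.

End HomDuality.

(** * Finite dimension and homogeneous components *)

Section Coordinates.
Variables (k : fieldType) (V : lmodType k).

(** If [e] kills a nonzero row [r], it stays surjective on a complement of [r], which has smaller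
    dimension. *)
Lemma coordinates_of_surj n (e : {linear 'rV[k]_n -> V}) :
  (forall v, exists u, e u = v) -> inhabited (coordinates V).
Proof.
elim/ltn_ind: n e => n IH e e_surj.
have [[r r0 er]|e_inj] := pselect (exists2 r : 'rV_n, r != 0 & e r = 0);
    last first.
  have [f fK] := choice e_surj.
  have eK u : f (e u) = u.
    apply/eqP; rewrite -subr_eq0; apply/negP => /negP fu; apply: e_inj.
    by exists (f (e u) - u) => //; rewrite linearB fK subrr.
  have fl : linear f by move=> r x y; rewrite -[RHS]eK linearP !fK.
  constructor.
  exact: (@Coordinates k V n e
    (HB.pack_for {linear V ->
        'rV[k]_n} f (GRing.isLinear.Build k V 'rV[k]_n *:%R f fl))).
have lt : (\rank (r^C)%MS < n)%N.
  rewrite mxrank_compl rank_rV r0 subn1 prednK //.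
  by case: n r r0 {e e_surj er IH} => // r; rewrite thinmx0 eqxx.
apply: (IH _ lt (e \o mulmxr (row_base (r^C)%MS))) => v.
have [u <-] := e_surj v.
have : (u <= r + r^C)%MS by apply: submx_full; exact: addsmx_compl_full.
move/sub_addsmxP => [[u1 u2] /= ->].
have /submxP[w wE] : (u2 *m r^C <= row_base (r^C))%MS by rewrite eq_row_base
    submxMl.
exists w => /=; rewrite -wE linearD /= [u1]mx11_scalar mul_scalar_mx linearZ /=
    er.
by rewrite scaler0 add0r.
Qed.

Definition lincomb (L : seq V) (u : 'rV[k]_(size L)) : V :=
  \sum_(i < size L) u 0 i *: L`_i.
Fact lincomb_linear L : linear (@lincomb L).
Proof.
move=> r u v; rewrite /lincomb scaler_sumr -big_split; apply: eq_bigr => i _ /=.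
by rewrite !mxE scalerDl scalerA.
Qed.
HB.instance Definition _ L :=
  GRing.isLinear.Build k 'rV[k]_(size L) V *:%R (@lincomb L)
      (@lincomb_linear L).

Definition kspan (L : seq V) (v : V) : Prop := exists u, @lincomb L u = v.

Lemma kspan_mem L v : v \in L -> kspan L v.
Proof.
move=> vL; have lt : (index v L < size L)%N by rewrite index_mem.
exists (delta_mx 0 (Ordinal lt));
    rewrite /lincomb (bigD1 (Ordinal lt)) //= big1.
  by rewrite mxE !eqxx scale1r addr0 nth_index.
by move=> i ne; rewrite mxE eqxx (negPf ne) scale0r.
Qed.

Lemma kspan_linear L r v w : kspan L v -> kspan L w -> kspan L (r *: v + w).
Proof.
by move=> [u <-] [u' <-]; exists (r *: u + u'); rewrite linearP.
Qed.

Lemma kspan0 L : kspan L 0.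
Proof. by exists 0; rewrite linear0. Qed.

Lemma kspan_ind L (P : V -> Prop) : P 0 ->
  (forall r v w, P v -> P w -> P (r *: v + w)) -> (forall v, v \in L -> P v) ->
  forall v, kspan L v -> P v.
Proof.
move=> P0 PL PM _ [u <-]; rewrite /lincomb.
apply: big_ind => [//|v w Pv Pw|i _]; first by rewrite -[v]scale1r; exact: PL.
by rewrite -[_ *: _]addr0; apply: PL => //; apply: PM; rewrite mem_nth.
Qed.

End Coordinates.

Section MonomialSpan.
Variables (k : fieldType) (c : nat) (a : 'I_c -> nat) (q : 'M[k]_c).
Hypothesis a_ge2 : forall i, (2 <= a i)%N.
Variables (N : qspace a q) (s : seq N).

Definition monomials (t : seq 'I_c) : seq N :=
  foldr (fun i L => [seq iter m (qop i) b | m <- iota 0 (a i), b <- L]) s t.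

Lemma monomials_gen t v : v \in s -> kspan (monomials t) v.
Proof.
move=> vs; apply: kspan_mem; elim: t => //= i t IH.
apply/allpairsP; exists (0%N, v); split=> //=.
by rewrite mem_iota /= add0n ltnW.
Qed.

(** x_l moves past the powers of the other generators at the cost of a scalar until it meets its own
    power, which it raises by one or kills at exponent a_l. *)
Lemma monomials_stable t l v : l \in t -> kspan (monomials t) v ->
  kspan (monomials t) (qop l v).
Proof.
elim: t v => //= i t IH v; rewrite inE => lit.
have mono m b : (m < a i)%N -> kspan (monomials t) b ->
    kspan (monomials (i :: t)) (iter m (qop i) b).
  move=> lt; apply: (@kspan_ind k N _
    (fun b => kspan (monomials (i :: t)) (iter m (qop i) b))) =>
        [|r x y Px Py|x xL].
  - by rewrite (linear_prop0 (iter_linear _ _)); exact: kspan0.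
  - by rewrite iter_linear; exact: kspan_linear.
  apply: kspan_mem; apply/allpairsP; exists (m, x); split=> //=.
  by rewrite mem_iota add0n.
apply: (@kspan_ind k N _ (fun b => kspan (monomials (i :: t)) (qop l b)))
  => [|r x y Px Py|x].
- by rewrite linear0; exact: kspan0.
- by rewrite linearP; exact: kspan_linear.
move=> /allpairsP[[m b] /= [ma bL ->]]; rewrite mem_iota add0n /= in ma.
have bS : kspan (monomials t) b by exact: kspan_mem.
have [li|li] := eqVneq l i.
  rewrite li -iterS; have [lt|ge] := ltnP m.+1 (a i); first exact: mono.
  have -> : m.+1 = a i by apply/eqP; rewrite eqn_leq ge andbT.
  by rewrite qop_nil; exact: kspan0.
have lt : l \in t by case/predU1P: lit li => [->|//]; rewrite eqxx.
have -> : qop l (iter m (qop i) b) = q l i ^+ m *: iter m (qop i) (qop l b).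
  elim: m {ma} => [|m IHm]; first by rewrite scale1r.
  by rewrite !iterS qop_comm IHm linearZ /= scalerA exprS.
by rewrite -[_ *: _]addr0; apply: kspan_linear; [apply: mono => //;
    exact: IH | exact: kspan0].
Qed.

End MonomialSpan.

Lemma sum_support (I : eqType) (V : zmodType) (s t : seq I) (u : I -> V) :
  uniq s -> uniq t -> {subset s <= t} -> (forall d, d \notin s -> u d = 0) ->
  \sum_(d <- t) u d = \sum_(d <- s) u d.
Proof.
move=> us ut st u0; rewrite (bigID (mem s)) /= [X in _ + X]big1 ?addr0 =>
    [|d /u0 //].
rewrite -big_filter; apply: perm_big; apply: uniq_perm => // [|d].
  exact: filter_uniq.
by rewrite mem_filter; apply: andb_idr => /st.
Qed.

Section HomogeneousComponents.
Variables (k : fieldType) (c : nat) (a : 'I_c -> nat) (q : 'M[k]_c).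
Variables (N : qspace a q) (comp : 'rV[int]_c -> N -> Prop).
Hypotheses (comp0 : forall d, comp d 0)
  (compB : forall d x y, comp d x -> comp d y -> comp d (x - y))
  (compZ : forall d r x, comp d x -> comp d (r *: x))
  (comp_op : forall d l x, comp d x -> comp (d + delta_mx 0 l) (qop l x))
  (comp_span : forall x, exists (s : seq 'rV[int]_c) (u : 'rV[int]_c -> N),
    (forall d, comp d (u d)) /\ x = \sum_(d <- s) u d)
  (comp_direct : forall (s : seq 'rV[int]_c) (u : 'rV[int]_c -> N),
    uniq s -> (forall d, comp d (u d)) -> \sum_(d <- s) u d = 0 ->
    forall d, d \in s -> u d = 0).

Let compD d x y : comp d x -> comp d y -> comp d (x + y).
Proof.
move=> cx cy; rewrite -[y]opprK; apply: compB => //; rewrite -[- y]sub0r.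
exact: compB.
Qed.

Let compMn d x n : comp d x -> comp d (x *+ n).
Proof. by move=> cx; elim: n => [|n IH]; rewrite ?mulr0n // mulrS;
    exact: compD. Qed.

Definition decomposes x (s : seq 'rV[int]_c) (u : 'rV[int]_c -> N) : Prop :=
  [/\ uniq s, forall d, comp d (u d), forall d, d \notin s -> u d = 0 &
      x = \sum_(d <- s) u d].

Lemma decomposes_ex x : exists s u, decomposes x s u.
Proof.
have [s [u [cu ->]]] := comp_span x.
(* The spanning sum may repeat a degree, always with the same term, so repetitions become
   multiplicities. *)
exists (undup s), (fun d => u d *+ count_mem d s); split.
- exact: undup_uniq.
- by move=> d; exact: compMn.
- by move=> d; rewrite mem_undup => /count_memPn ->.
rewrite -big_undup_iterop_count; apply: eq_bigr => d _.
by elim: (count_mem d s) => // -[|n] //= ->; rewrite mulrS.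
Qed.

Lemma decomposes_unique x s u s' u' :
  decomposes x s u -> decomposes x s' u' -> u =1 u'.
Proof.
move=> [us cu u0 xE] [us' cu' u0' xE'] d; apply/eqP; rewrite -subr_eq0;
    apply/eqP.
pose t := undup (s ++ s').
have [dt|] := boolP (d \in t); last first.
  by rewrite mem_undup mem_cat negb_or => /andP[/u0 -> /u0' ->]; rewrite subr0.
apply: (comp_direct (s := t) (u := fun d => u d - u' d)) => [|e||//].
- exact: undup_uniq.
- exact: compB.
rewrite sumrB (sum_support us (t := t)) ?undup_uniq // => [|e es]; last first.
  by rewrite mem_undup mem_cat es.
rewrite (sum_support us' (t := t)) ?undup_uniq // => [|e es]; last first.
  by rewrite mem_undup mem_cat es orbT.
by rewrite -xE -xE' subrr.
Qed.

Lemma graded_space_of_components : inhabited (coordinates N) ->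
  inhabited (graded_space N).
Proof.
move=> [cN].
have [S SP] := choice decomposes_ex; have [p pP] := choice SP.
pose gpart d x := p x d.
have gpE x s u : decomposes x s u -> forall d, gpart d x = u d.
  by move=> xu d; rewrite /gpart (decomposes_unique (pP x) xu).
have gl d : linear (gpart d).
  move=> r x y; have [us cu u0 xE] := pP x; have [us' cu' u0' yE] := pP y.
  rewrite (gpE _ (undup (S x ++ S y)) (fun d => r *: p x d + p y d)) //; split.
  - exact: undup_uniq.
  - by move=> e; apply: compD => //; exact: compZ.
  - move=> e; rewrite mem_undup mem_cat negb_or => /andP[/u0 -> /u0' ->].
    by rewrite scaler0 addr0.
  rewrite big_split /= -scaler_sumr.
  rewrite (sum_support us (t := undup (S x ++ S y))) ?undup_uniq //; last first.
    by move=> e es; rewrite mem_undup mem_cat es.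
  rewrite (sum_support us' (t :=
      undup (S x ++ S y))) ?undup_uniq -?xE -?yE // => e es.
  by rewrite mem_undup mem_cat es orbT.
(* The degrees that occur in some basis vector; finite dimension is what makes the support
   finite. *)
pose D := undup (flatten [seq S (ofrow cN (delta_mx 0 j)) | j <- enum 'I_(cdim
    cN)]).
have gout d v : d \notin D -> gpart d v = 0.
  move=> dD; rewrite -[v](torowK cN) [torow cN v]row_sum_delta linear_sum.
  rewrite (linear_prop_sum (gl d)) big1 // => j _.
  rewrite linearZ (linear_propZ (gl d)) [gpart _ _](_ : _ = 0) ?scaler0 //.
  have [_ _ u0 _] := pP (ofrow cN (delta_mx 0 j)); apply: u0.
  apply: contra dD => dS; rewrite mem_undup; apply/flattenP.
  by exists (S (ofrow cN (delta_mx 0 j))) => //; apply: map_f; rewrite mem_enum.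
pose G d : {linear N -> N} :=
  HB.pack_for {linear N -> N} (gpart d)
      (GRing.isLinear.Build k N N *:%R (gpart d) (gl d)).
constructor; apply: (@GradedSpace k c a q N G D).
- exact: undup_uniq.
- move=> d e v; have [_ cu _ _] := pP v.
  transitivity (if d == e then gpart e v else 0); last by case: eqP => [->|].
  apply: (gpE _ [:: e] (fun d => if d == e then gpart e v else 0)); split=> //.
  + by move=> d'; case: eqP => [->|_]; [exact: cu | exact: comp0].
  + by move=> d'; rewrite inE => /negPf ->.
  + by rewrite big_seq1 eqxx.
- exact: gout.
- move=> v; have [us cu u0 vE] := pP v.
  rewrite {1}vE -(sum_support us (t := undup (S v ++ D))) ?undup_uniq //;
      last first.
    by move=> e es; rewrite mem_undup mem_cat es.
  apply: (sum_support (s := D)) => [||e es|e eD]; try exact: undup_uniq.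
    by rewrite mem_undup mem_cat es orbT.
  exact: gout.
- move=> d l v; have [us cu u0 vE] := pP v.
  transitivity (qop l (gpart (d + delta_mx 0 l - delta_mx 0 l) v));
      last by rewrite addrK.
  apply: (gpE _ [seq e + delta_mx 0 l | e <- S v]
    (fun d => qop l (gpart (d - delta_mx 0 l) v))); split.
  + by rewrite map_inj_uniq //; exact: addIr.
  + by move=> e; rewrite -{1}[e](subrK (delta_mx 0 l)); exact: comp_op.
  + move=> e eS; rewrite /gpart u0 ?linear0 //; apply: contra eS => eS.
    by apply/mapP; exists (e - delta_mx 0 l); rewrite ?subrK.
  + rewrite big_map {1}vE linear_sum; apply: eq_bigr => e _.
    by rewrite addrK.
Qed.

End HomogeneousComponents.

(** * The quantum complete intersection and its modules *)

Lemma malgU_scale (R : nzRingType) (K : choiceType) (r : R) (x : K) :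
  << r *g x >> = r *: (<< x >> : {malg R[K]}).
Proof. by apply/malgP => y; rewrite mcoeffZ !mcoeffU mulrnAr mulr1. Qed.

Section QciAlgebra.
Variables (k : fieldType) (c : nat) (a : 'I_c -> nat) (q : 'M[k]_c).
Variable a_ge2 : forall i, (2 <= a i)%N.
Let A := qci q a_ge2.
Let F := free_alg k c.
Let pi (f : F) : A := qci_pi q a_ge2 f.

Definition qgen (i : 'I_c) : A := pi (freeX k i).

Let piM f g : pi (f * g) = pi f * pi g.
Proof. exact/esym/(quot_piM (@qci_proper k c a q a_ge2)). Qed.
Let piZ r f : pi (r *: f) = r *: pi f.
Proof. exact/esym/(quot_piZ (@qci_proper k c a q a_ge2)). Qed.
Let piB f g : pi (f - g) = pi f - pi g.
Proof. exact: (raddfB (quot_pi (@qci_proper k c a q a_ge2))). Qed.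
Let piD f g : pi (f + g) = pi f + pi g.
Proof. exact: (raddfD (quot_pi (@qci_proper k c a q a_ge2))). Qed.
Let pi0 : pi 0 = 0.
Proof. exact: (raddf0 (quot_pi (@qci_proper k c a q a_ge2))). Qed.
Let piX f n : pi (f ^+ n) = pi f ^+ n.
Proof. by elim: n => [|n IH]; rewrite ?expr0 // !exprS piM IH. Qed.

Let rp (x : A) : F := @quot_repr _ _ _ (@qci_proper k c a q a_ge2) x.
Let rpK x : pi (rp x) = x.
Proof. exact: quot_reprK. Qed.

Let pi_relator f : qci_relator a q f -> pi f = 0.
Proof.
move=> rf; rewrite -pi0; apply/quot_piP; rewrite subr0; exact: tsi_gen.
Qed.

Lemma qgen_nil i : qgen i ^+ a i = 0.
Proof. by rewrite -piX pi_relator //; exact: qci_power. Qed.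

Lemma qgen_comm i j : qgen i * qgen j = q i j *: (qgen j * qgen i).
Proof.
apply/eqP; rewrite -subr_eq0 -!piM -piZ -piB pi_relator //.
exact: qci_commute.
Qed.

(** A is spanned by words in the generators. With the two relations and [orbit_map] this is all that
    is used of the quotient. *)
Lemma qci_ind (P : A -> Prop) : P 1 ->
  (forall r x y, P x -> P y -> P (r *: x + y)) ->
  (forall i x, P x -> P (qgen i * x)) -> forall x, P x.
Proof.
move=> P1 PL PX x.
have P0 : P 0 by rewrite -[0](addNr 1) -scaleN1r; exact: PL.
rewrite -[x]quot_reprK; move: (quot_repr x) => f {x}.
rewrite [f]monalgE.
have -> : quot_pi (@qci_proper k c a q a_ge2)
    (\sum_(w <- msupp f) << f@_w *g w >>) =
    \sum_(w <- msupp f) (f@_w *: pi << w >>).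
  rewrite raddf_sum; apply: eq_bigr => w _; rewrite -piZ; congr (pi _).
  exact: malgU_scale.
apply: big_ind => [//|u v Pu Pv|w _]; first by rewrite -[u]scale1r; exact: PL.
rewrite -[_ *: _]addr0; apply: PL => //; case: w => w; elim: w => [|i w IH].
  by rewrite -fmoneE.
have -> : << FMonom (i :: w) >> = freeX k i * (<< FMonom w >> : F).
  rewrite [RHS]fgmulUU mulr1; congr mkmalgU.
  by apply: val_inj; rewrite /= fmM fmuE.
by rewrite piM; exact: PX.
Qed.

Section Orbit.
Variables (V : qspace a q).

Let wact (w : {fmonom 'I_c}) (v : V) : V := foldr (fun l u => qop l u) v w.
Let act (f : F) (v : V) : V := free_ext (fun w => wact w v) (f : {malg k[_]}).

Let wact_linear w : linear (wact w).
Proof.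
by case: w => w r u v; rewrite /wact /=; elim: w => //= l w ->; rewrite linearP.
Qed.

Let actP v r f g : act (r *: f + g) v = r *: act f v + act g v.
Proof. exact: linearP. Qed.

Let actB v f g : act (f - g) v = act f v - act g v.
Proof. exact: linearB. Qed.

Let actZ v r f : act (r *: f) v = r *: act f v.
Proof. exact: linearZZ. Qed.

Let act_sum v I (r : seq I) (G : I -> F) :
  act (\sum_(t <- r) G t) v = \sum_(t <- r) act (G t) v.
Proof. exact: linear_sum. Qed.

Let actU r w v : act << r *g w >> v = r *: wact w v.
Proof.
by rewrite malgU_scale [LHS]actZ {1}/act free_extU.
Qed.

Let actM f g v : act (f * g) v = act f (act g v).
Proof.
rewrite [f * g]malgME act_sum {2}/act /free_ext; apply: eq_bigr => w _.
rewrite act_sum {2}/act /free_ext (linear_prop_sum (wact_linear w)) scaler_sumr.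
apply: eq_bigr => w' _; rewrite actU (linear_propZ (wact_linear w)) scalerA.
by congr (_ *: _); rewrite /wact fmM foldr_cat.
Qed.

Let act1 v : act 1 v = v.
Proof.
have -> : (1 : F) = << (mone : {fmonom 'I_c}) >> by [].
by rewrite actU scale1r /wact fm1.
Qed.

Let act_linear f : linear (act f).
Proof.
move=> r u v; rewrite /act /free_ext scaler_sumr -big_split; apply: eq_bigr =>
    w _ /=.
by rewrite wact_linear scalerDr !scalerA mulrC.
Qed.

Let act_gen l v : act (freeX k l) v = qop l v.
Proof. by rewrite /act free_extU /wact fmuE. Qed.

Let act_ideal f v : two_sided_ideal (qci_relator a q) f -> act f v = 0.
Proof.
(* [v] is generalised because in a product f g with f in the ideal, f acts on the vector
   [act g v]. *)
move=> If; elim: If v => {f} [f [i|i j]||f g _ f0 _ g0|f g _ g0|f g _ f0] v.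
- transitivity (iter (a i) (qop i) v); last exact: qop_nil.
  elim: (a i) => [|n IH].
    by rewrite expr0 act1.
  by rewrite exprS actM IH act_gen.
- have E i' j' : act (freeX k i' * freeX k j') v = qop i' (qop j' v).
    by rewrite actM !act_gen.
  apply: (etrans (actB _ _ _)); apply/eqP; rewrite subr_eq0; apply/eqP.
  apply: (etrans (E _ _)); apply: (etrans (qop_comm _ _ _)).
  by apply/esym/(etrans (actZ _ _ _)); congr (_ *: _); exact: E.
- exact: linear0.
- by rewrite actB f0 g0 subrr.
- by rewrite actM g0 (linear_prop0 (act_linear f)).
- by rewrite actM f0.
Qed.

(** The universal property of the presentation: words act on [V] through the operators and the
    relators act by zero, so x |-> x v does not depend on the representative of x. *)
Lemma orbit_map (v : V) : exists h : A -> V,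
  [/\ linear h, h 1 = v & forall l x, h (qgen l * x) = qop l (h x)].
Proof.
exists (fun x => act (rp x) v).
have hE f : act (rp (pi f)) v = act f v.
  apply/eqP; rewrite -subr_eq0 -actB; apply/eqP/act_ideal.
  by apply/(quot_piP (@qci_proper k c a q a_ge2)); exact: rpK.
split=> [r x y||l x].
- have [f <-] : exists f : F, pi f = x by exists (rp x).
  have [g <-] : exists g : F, pi g = y by exists (rp y).
  by rewrite -piZ -piD !hE actP.
- by rewrite -[1]/(pi 1) hE act1.
- have [f <-] : exists f : F, pi f = x by exists (rp x).
  by rewrite /qgen -piM !hE actM act_gen.
Qed.

End Orbit.

End QciAlgebra.

(** * From modules over the algebra to spaces with operators *)

Section RestrictionOfScalars.
Variables (k : fieldType) (A : algType k) (N : lmodType A).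

Definition kmod : Type := N.
HB.instance Definition _ := GRing.Zmodule.on kmod.
Definition kscale (r : k) (x : kmod) : kmod := (r%:A : A) *: (x : N).
Fact kscaleA r s x : kscale r (kscale s x) = kscale (r * s) x.
Proof. by rewrite /kscale scalerA -scalerAl mul1r scalerA. Qed.
Fact kscale1 : left_id 1 kscale.
Proof. by move=> x; rewrite /kscale !scale1r. Qed.
Fact kscaleDr : right_distributive kscale +%R.
Proof. by move=> r x y; rewrite /kscale scalerDr. Qed.
Fact kscaleDl x : {morph kscale^~ x : r s / r + s}.
Proof. by move=> r s; rewrite /kscale !scalerDl. Qed.
HB.instance Definition _ := GRing.Zmodule_isLmodule.Build k kmod
  kscaleA kscale1 kscaleDr kscaleDl.

Lemma kscaleE (r : k) (x : kmod) : r *: x = ((r%:A : A) *: (x : N)).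
Proof. by []. Qed.

End RestrictionOfScalars.

Section QciModules.
Variables (k : fieldType) (c : nat) (a : 'I_c -> nat) (q : 'M[k]_c).
Variables (A : algType k) (X : 'I_c -> A).
(** An interface that hides the quotient construction: relations, generation, and maps out of A
    given by vectors satisfying the relations. *)
Hypotheses (X_nil : forall i, X i ^+ a i = 0)
  (X_comm : forall i j, X i * X j = q i j *: (X j * X i))
  (X_ind : forall P : A -> Prop, P 1 ->
    (forall r x y, P x -> P y -> P (r *: x + y)) ->
    (forall i x, P x -> P (X i * x)) -> forall x, P x)
  (X_orbit : forall (V : qspace a q) (v : V), exists h : A -> V,
    [/\ linear h, h 1 = v & forall l x, h (X l * x) = qop l (h x)]).
Hypothesis a_ge2 : forall i, (2 <= a i)%N.
Hypothesis q_comm : (forall i, q i i = 1) /\ (forall i j, q i j * q j i = 1).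

Section QMod.
Variable N : lmodType A.

Definition gact (l : 'I_c) (x : kmod N) : kmod N := X l *: (x : N).
Fact gact_linear l : linear (gact l).
Proof.
move=> r x y; change (X l *: ((r%:A : A) *: (x : N) + (y : N)) =
  (r%:A : A) *: (X l *: (x : N)) + X l *: (y : N)).
by rewrite scalerDr !scalerA -scalerAr -scalerAl mul1r mulr1.
Qed.
HB.instance Definition _ l :=
  GRing.isLinear.Build k (kmod N) (kmod N) *:%R (gact l) (gact_linear l).

Lemma iter_gact l m x : iter m (gact l) x = X l ^+ m *: (x : N).
Proof.
elim: m => [|m IH]; first by rewrite scale1r.
by rewrite iterS IH /gact scalerA exprS.
Qed.

Fact gact_nil l x : iter (a l) (gact l) x = 0.
Proof. by rewrite iter_gact X_nil scale0r. Qed.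

Fact gact_comm i j x : gact i (gact j x) = q i j *: gact j (gact i x).
Proof.
change (X i *: (X j *: (x : N)) =
    ((q i j)%:A : A) *: (X j *: (X i *: (x : N)))).
by rewrite !scalerA X_comm -!scalerAl mul1r.
Qed.

Definition qmod : qspace a q :=
    @QSpace k c a q (kmod N) gact gact_nil gact_comm.

End QMod.

Section ShiftSpace.
Variable i : 'I_c.
Let V := nat -> A.

(** The sequence v stands for the formal sum of the x_i^m v_m. Left multiplication by x_i shifts it,
    truncated at a_i, and x_l x_i^m = q_li^m x_i^m x_l gives the other generators. *)
Definition shift (l : 'I_c) (v : V) : V := fun m =>
  if l == i then (if (0 < m < a i)%N then v m.-1 else 0)
  else q l i ^+ m *: (X l * v m).

Fact shift_linear l : linear (shift l).
Proof.
move=> r u v; apply/funext => m; rewrite /shift.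
change (shift l (r *: u + v) m = r *: shift l u m + shift l v m);
    rewrite /shift.
case: eqP => _; first by case: ifP => // _; rewrite scaler0 addr0.
change ((r *: u + v) m) with (r *: u m + v m).
by rewrite mulrDr -scalerAr scalerDr !scalerA mulrC.
Qed.
HB.instance Definition _ l :=
  GRing.isLinear.Build k V V *:%R (shift l) (shift_linear l).

Fact shift_nil l (v : V) : iter (a l) (shift l) v = 0.
Proof.
apply/funext => m; rewrite [RHS]/(0 : A).
have [->|li] := eqVneq l i.
  have [lt|ge] := ltnP m (a i); last first.
    rewrite -(prednK (ltnW (a_ge2 i))) iterS {1}/shift eqxx.
    by case: ifP => //; lia.
  suff H n r : (r < n)%N -> iter n (shift i) v r = 0 by exact: H.
  elim: n r => // n IH r ltr; rewrite iterS {1}/shift eqxx.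
  by case: ifP => // /andP[r0 _]; apply: IH; lia.
have [r ->] : exists r, iter (a l) (shift l) v m = r *: (X l ^+ a l * v m).
  elim: (a l) => [|n [r IH]]; first by exists 1; rewrite scale1r mul1r.
  exists (q l i ^+ m * r); rewrite iterS {1}/shift (negPf li) IH.
  by rewrite -scalerAr scalerA mulrA exprS.
by rewrite X_nil mul0r scaler0.
Qed.

Fact shift_comm j l (v : V) : shift j (shift l v) =
    q j l *: shift l (shift j v).
Proof.
apply/funext => m; change ((q j l *: shift l (shift j v)) m)
  with (q j l *: shift l (shift j v) m); rewrite /shift.
have [->|ji] := eqVneq j i; have [->|li] := eqVneq l i.
- by rewrite q_comm.1 scale1r.
- case: ifP => [/andP[m0 _]|_]; last by rewrite mulr0 !scaler0.
  by rewrite scalerA -[in RHS](prednK m0) exprS mulrA q_comm.2 mul1r.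
- case: ifP => [/andP[m0 _]|_]; last by rewrite mulr0 !scaler0.
  by rewrite scalerA -{1}(prednK m0) exprS.
rewrite -!scalerAr !scalerA !mulrA X_comm -scalerAl scalerA.
by congr (_ *: _); ring.
Qed.

Definition shift_space : qspace a q :=
  @QSpace k c a q (V : lmodType k) shift shift_nil shift_comm.

(** The coefficients of x are read off from its action on the sequence (1, 0, 0, ...). [X_orbit]
    makes them well defined, so no monomial basis of A is required. *)
Lemma qci_coefficients : exists b : nat -> A -> A,
  [/\ forall m, linear (b m), forall x, b 0 (X i * x) = 0,
      forall m x, (m.+1 < a i)%N -> b m.+1 (X i * x) = b m x,
      forall m l x, l != i -> b m (X l * x) = q l i ^+ m *: (X l * b m x) &
      forall x, x = \sum_(m < a i) X i ^+ m * b m x].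
Proof.
have [h [hl h1 hX]] := X_orbit (V := shift_space) (fun m => (m == 0)%:R : A).
exists (fun m x => h x m); split=> [m r x y|x|m x lt|m l x li|].
- by rewrite hl.
- by rewrite hX /= /shift eqxx.
- by rewrite hX /= /shift eqxx /= lt.
- by rewrite hX /= /shift (negPf li).
elim/X_ind => [|r x y xE yE|l x xE].
- rewrite h1; case: (a i) (a_ge2 i) => // n _;
    rewrite big_ord_recl big1 ?addr0 ?mulr1 //.
  by move=> m _; rewrite mulr0.
- rewrite {1}xE {1}yE scaler_sumr -big_split; apply: eq_bigr => m _.
  rewrite hl; change ((r *: h x + h y) m) with (r *: h x m + h y m).
  by rewrite mulrDr -scalerAr.
rewrite {1}xE mulr_sumr hX /= /shift; have [->|li] := eqVneq l i; last first.
  apply: eq_bigr => m _; rewrite -scalerAr !mulrA.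
  have -> j : X i ^+ j * X l = q i l ^+ j *: (X l * X i ^+ j).
    elim: j => [|j IH]; first by rewrite scale1r mul1r mulr1.
    rewrite exprSr -mulrA X_comm -scalerAr [X i ^+ j * (_ * _)]mulrA IH
        -scalerAl scalerA.
    by rewrite -exprS -mulrA.
  by rewrite scalerAl scalerA -exprMn q_comm.2 expr1n scale1r.
(* Multiplication by x_i shifts the expansion by one, and the term pushed to exponent a_i is
   zero. *)
case: (a i) (a_ge2 i) (X_nil i) => // n _ nil0.
rewrite big_ord_recr big_ord_recl /= [X in _ = X + _]mulr0 add0r.
rewrite mulrA -exprS nil0 mul0r addr0; apply: eq_bigr => m _.
by rewrite /bump /= ?add1n ltnS ltn_ord mulrA -exprS.
Qed.

End ShiftSpace.

End QciModules.

Section CohomologyVanishing.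
Local Open Scope quotient_scope.

Lemma cohomology_eq0 (C : nat -> zmodType) (delta : forall n, {additive C n ->
    C n.+1}) n :
  (forall x : cohomology delta n.+1, x = 0) <->
  (forall z : C n.+1, delta n.+1 z = 0 -> exists y, z = delta n y).
Proof.
split=> [H z dz|H x].
  have zP : z \in @cocycle_pred C delta n.+1 by apply/eqP.
  have := H (\pi_(cohomology delta n.+1) (Cocycle zP)).
  move/eqP; rewrite -[0](raddf0 (\pi_(cohomology delta n.+1))) /=.
  rewrite piE Quotient.equivE subr0 => /asboolP //.
rewrite -[x]reprK; set z := repr x.
apply/eqP; rewrite -[0](raddf0 (\pi_(cohomology delta n.+1))) /=.
rewrite piE Quotient.equivE subr0; apply/asboolP => /=.
by apply: H; exact/eqP/(cocycleP z).
Qed.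

End CohomologyVanishing.

(** * Free modules, the standard resolution and Ext *)

Section QciModules.
Variables (k : fieldType) (c : nat) (a : 'I_c -> nat) (q : 'M[k]_c).
Variables (A : algType k) (X : 'I_c -> A).
Hypotheses (X_nil : forall i, X i ^+ a i = 0)
  (X_comm : forall i j, X i * X j = q i j *: (X j * X i))
  (X_ind : forall P : A -> Prop, P 1 ->
    (forall r x y, P x -> P y -> P (r *: x + y)) ->
    (forall i x, P x -> P (X i * x)) -> forall x, P x)
  (X_orbit : forall (V : qspace a q) (v : V), exists h : A -> V,
    [/\ linear h, h 1 = v & forall l x, h (X l * x) = qop l (h x)]).
Hypothesis a_ge2 : forall i, (2 <= a i)%N.
Hypothesis q_comm : (forall i, q i i = 1) /\ (forall i j, q i j * q j i = 1).

Local Notation qmod := (qmod X_nil X_comm).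

Section FreeSplitting.
Variables (K : choiceType) (i : 'I_c).

Definition coefmap (b : A -> A) (g : {malg A[K]}) : {malg A[K]} :=
  [malg x in msupp g => b g@_x].

Lemma coefmapE b g x : b 0 = 0 -> (coefmap b g)@_x = b g@_x.
Proof.
by move=> b0; rewrite mcoeffE; case: ifP => // /negbT /mcoeff_outdom ->.
Qed.

Lemma coefmap_linear b : linear b ->
  linear (coefmap b : kmod {malg A[K]} -> kmod {malg A[K]}).
Proof.
move=> bl r x y; have b0 := linear_prop0 bl.
apply/malgP => z; rewrite coefmapE // !kscaleE !mcoeffD !mcoeffZ !coefmapE //.
by rewrite -!scalerAl !mul1r bl.
Qed.

(** Generators act on a free module by left multiplication of its coefficients, so the expansion in
    A is applied to each coefficient. *)
Definition free_splitting : splitting (qmod {malg A[K]}) i.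
Proof.
have [b [bl b0 bS bop bsum]] :=
  cid (qci_coefficients X_nil X_comm X_ind X_orbit a_ge2 q_comm i).
have bz m : b m 0 = 0 := linear_prop0 (bl m).
pose B m : {linear kmod {malg A[K]} -> kmod {malg A[K]}} :=
  HB.pack_for {linear kmod {malg A[K]} -> kmod {malg A[K]}} (coefmap (b m))
    (GRing.isLinear.Build k (kmod {malg A[K]}) (kmod {malg A[K]}) *:%R
       (coefmap (b m)) (coefmap_linear (bl m))).
have BE m g x : (B m g : {malg A[K]})@_x = b m g@_x by exact: coefmapE.
apply: (@Splitting k c a q (qmod {malg A[K]}) i B).
- by move=> g; apply/malgP => x; rewrite BE mcoeffZ b0 mcoeff0.
- by move=> m g lt; apply/malgP => x; rewrite !BE mcoeffZ bS.
- move=> m l g li; apply/malgP => x; rewrite !BE mcoeffZ bop //.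
  by rewrite kscaleE !mcoeffZ BE -scalerAl mul1r.
- move=> g; apply/malgP => x; rewrite [LHS]bsum raddf_sum; apply: eq_bigr =>
    m _.
  by rewrite /= iter_gact mcoeffZ BE.
Defined.

End FreeSplitting.

Section ScalarLinear.
Variables (U V : lmodType A).

Lemma restrict_linear (f : {linear U -> V}) : linear (f : kmod U -> kmod V).
Proof. by move=> r x y; exact: linearP. Qed.

Lemma hom_enumP (f : U -> V) :
  @hom k c a q (qmod U) (qmod V) (enum 'I_c) f <-> linear f.
Proof.
split=> [[fl fX] r x y|fl].
  have fD u v : f (u + v) = f u + f v by exact: (linear_propD fl).
  rewrite fD; congr (_ + _); elim/X_ind: r x => [|s r t IHr IHt|i r IHr] x.
  - by rewrite !scale1r.
  - have fs z : f (s%:A *: z) = s%:A *: f z by exact: (linear_propZ fl).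
    have E (W : lmodType A) (z : W) : (s *: r + t) *: z =
        s%:A *: (r *: z) + t *: z.
      by rewrite scalerDl scalerA -scalerAl mul1r.
    by rewrite !E fD fs IHr IHt.
  - rewrite -!scalerA -IHr.
    by apply: (fX i); rewrite mem_enum.
split=> [r x y|l _ x]; first exact: fl.
by have := fl (X l) x 0; rewrite (linear_prop0 fl) !addr0.
Qed.

End ScalarLinear.

Lemma coordinates_of_fg (M : lmodType A) :
  finitely_generated M -> inhabited (coordinates (qmod M)).
Proof.
move=> [s sP]; pose L := @monomials k c a q (qmod M) s (enum 'I_c).
suff span (v : qmod M) : kspan L v.
  by apply: (@coordinates_of_surj k (qmod M) _ (@lincomb k (qmod M) L));
      exact: span.
have stable (r : A) (u : M) : @kspan k (qmod M) L u ->
    @kspan k (qmod M) L (r *: u).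
  elim/X_ind: r u => [|r x y IHx IHy|l x IHx] u uL.
  - by rewrite scale1r.
  - rewrite scalerDl (_ : r *: x = r%:A * x); last by rewrite -scalerAl mul1r.
    rewrite -scalerA.
    change (@kspan k (qmod M) L (r *: (x *: u : kmod M) + (y *: u : kmod M))).
    by apply: kspan_linear; [exact: IHx | exact: IHy].
  - rewrite -scalerA.
    have lin : l \in enum 'I_c by rewrite mem_enum.
    exact: (@monomials_stable k c a q (qmod M) s (enum 'I_c) l (x *: u) lin
        (IHx u uL)).
have [r ->] := sP v; apply: (big_ind (@kspan k (qmod M) L)).
- exact: kspan0.
- by move=> x y Px Py; rewrite -[x](@scale1r k (qmod M)); exact: kspan_linear.
- move=> i _; apply: stable; apply: monomials_gen => //.
  by rewrite mem_nth.
Qed.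

Section Extensions.
Variables (M N : lmodType A).

Definition res_space n : qspace a q := qmod (res M n).

Fact res_dk_linear n : linear (res_d M n : kmod (res M n.+1) -> kmod (res M n)).
Proof. exact: restrict_linear. Qed.
Definition res_dk n : {linear res_space n.+1 -> res_space n} :=
  HB.pack_for {linear res_space n.+1 -> res_space n} (res_d M n : _ -> _)
    (GRing.isLinear.Build k (kmod (res M n.+1)) (kmod (res M n)) *:%R
       (res_d M n : _ -> _) (@res_dk_linear n)).

Fact res_augk_linear : linear (res_aug M : kmod (res M 0) -> kmod M).
Proof. exact: restrict_linear. Qed.
Definition res_augk : {linear res_space 0 -> qmod M} :=
  HB.pack_for {linear res_space 0 -> qmod M} (res_aug M : _ -> _)
    (GRing.isLinear.Build k (kmod (res M 0)) (kmod M) *:%R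
       (res_aug M : _ -> _) res_augk_linear).

(** A-linear maps are the k-linear maps commuting with every x_l. The shifted index of [hom_acyclic]
    leaves out degree 0, where Ext is Hom. *)
Lemma Ext_vanishesE n : Ext_vanishes n.+1 M N <->
  hom_acyclic (qmod N) res_dk (enum 'I_c) n.
Proof.
rewrite /Ext_vanishes /Ext cohomology_eq0; split=> H.
  move=> f /hom_enumP fl df.
  pose F : Defs.Hom (res M n.+1) N := HB.pack_for {linear res M n.+1 -> N} f
    (GRing.isLinear.Build A (res M n.+1) N *:%R f fl).
  have [|G GE] := H F.
    by apply: HomP => x; exact: (congr1 (fun h => h x) df).
  exists (G : _ -> _); first by apply/hom_enumP; exact: linearP.
  by have -> : f = F by []; rewrite GE.
move=> F dF; have [||g /hom_enumP gl gE] := H (F : _ -> _).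
- by apply/hom_enumP; exact: linearP.
- apply/funext => x.
  exact: (congr1 (fun h : Defs.Hom (res M n.+2) N => (h : {linear _ -> _})
      (x : res M n.+2)) dF).
exists (HB.pack_for {linear res M n -> N} g
    (GRing.isLinear.Build A (res M n) N *:%R g gl)).
by apply: HomP => x; exact: (congr1 (fun h => h x) gE).
Qed.

Let d_qop n l x : res_dk n (qop l x) = qop l (res_dk n x).
Proof. exact: (linearZZ (res_d M n) (X l) (x : res M n.+1)). Qed.
Let e_qop l x : res_augk (qop l x) = qop l (res_augk x).
Proof. exact: (linearZZ (res_aug M) (X l) (x : res M 0)). Qed.
Let e_surj y : exists x, res_augk x = y. Proof. exact: res_aug_surj. Qed.
Let e_exact x : res_augk x = 0 <-> exists y, x = res_dk 0 y.
Proof. exact: (@res_aug_exact A M x). Qed.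
Let d_exact n x : res_dk n x = 0 <-> exists y, x = res_dk n.+1 y.
Proof. exact: (@res_exact A M n x). Qed.
Let P_split n i : splitting (res_space n) i.
Proof. exact: free_splitting. Defined.

Variable w : twist (qmod N).

Lemma exact_of_Ext_vanishes :
  (exists n0, forall n, (n0 <= n)%N -> Ext_vanishes n M N) ->
  forall i, exact_pair (hom_op w i) (@hom k c a q (qmod M) (qmod N) [::]).
Proof.
move=> [n0 Hn0]; apply: (exact_of_acyclic q_comm a_ge2 d_qop e_qop e_surj
    e_exact d_exact P_split (n0 := n0)).
by move=> n le; apply/Ext_vanishesE; apply: Hn0; exact: leqW.
Qed.

Lemma Ext_vanishes_of_exact :
  (forall i s, i \notin s ->
     exact_pair (hom_op w i) (@hom k c a q (qmod M) (qmod N) s)) ->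
  forall n, (0 < n)%N -> Ext_vanishes n M N.
Proof.
move=> ex [//|n] _; apply/Ext_vanishesE; move: n.
exact: (acyclic_of_exact q_comm a_ge2 d_qop e_qop e_surj e_exact d_exact
    P_split ex).
Qed.

End Extensions.

End QciModules.

(** * Symmetry of Ext vanishing over the quantum complete intersection *)

Section Main.
Variables (k : fieldType) (c : nat) (a : 'I_c -> nat) (q : 'M[k]_c).
Variable a_ge2 : forall i, (2 <= a i)%N.
Hypothesis q_comm : commutation_matrix q.
Local Notation A := (qci q a_ge2).
Local Notation qmod := (qmod (@qgen_nil k c a q a_ge2)
    (@qgen_comm k c a q a_ge2)).

Section FiniteDimension.
Variable M : lmodType A.

Lemma qci_component_scalar r : qci_component 0 (r%:A : A).
Proof.
exists (r *: (1 : free_alg k c)); last first.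
  exact: (quot_piZ (@qci_proper k c a q a_ge2) r 1).
move=> w /(fsubsetP (msuppZ_le _ _)); rewrite msuppU1 inE => /eqP ->.
by rewrite /word_degree fm1 big_nil.
Qed.

Lemma qci_component_gen l : qci_component (delta_mx 0 l) (qgen q a_ge2 l).
Proof.
exists (freeX k l) => // w; rewrite msuppU1 inE => /eqP ->.
by rewrite /word_degree fmuE big_seq1.
Qed.

Lemma graded_space_of_grading : grading M -> finitely_generated M ->
  inhabited (graded_space (qmod M)).
Proof.
move=> g fg; apply: (@graded_space_of_components k c a q (qmod M)
    (component g)).
- exact: component0.
- exact: componentB.
- move=> d r x cx; rewrite -[d]add0r.
  exact: (componentZ (qci_component_scalar r) cx).
- move=> d l x cx; rewrite addrC.
  exact: (componentZ (qci_component_gen l) cx).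
- exact: component_span.
- exact: component_direct.
- exact: (coordinates_of_fg _ _ (@qci_ind k c a q a_ge2) a_ge2 fg).
Qed.

End FiniteDimension.

(** The exactness found on Hom_k(M, N) uses the twist of N, the one needed on Hom_k(N, M) that of M;
    the duality passes between them. *)
Lemma Ext_vanishing_swap (M N : lmodType A) :
  finitely_generated M -> finitely_generated N -> grading M -> grading N ->
  (exists n0, forall n, (n0 <= n)%N -> Ext_vanishes n M N) ->
  forall n, (0 < n)%N -> Ext_vanishes n N M.
Proof.
move=> fM fN gM gN van.
have [hM] := graded_space_of_grading gM fM.
have [hN] := graded_space_of_grading gN fN.
have Xind := @qci_ind k c a q a_ge2; have Xorb := @orbit_map k c a q a_ge2.
have [cM] := coordinates_of_fg (@qgen_nil k c a q a_ge2)
    (@qgen_comm k c a q a_ge2) Xind a_ge2 fM.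
have [cN] := coordinates_of_fg (@qgen_nil k c a q a_ge2)
    (@qgen_comm k c a q a_ge2) Xind a_ge2 fN.
have exMN := exact_of_Ext_vanishes Xind Xorb a_ge2 q_comm (w :=
    graded_twist q_comm hN) van.
apply: (Ext_vanishes_of_exact Xind Xorb a_ge2 q_comm (w :=
    graded_twist q_comm hM)).
apply: (@hom_exact_all k c a q q_comm a_ge2 (qmod N) (qmod M) hN hM) => i.
exact: (@hom_exact_dual k c a q q_comm a_ge2 i (qmod M)
    (qmod N) cM cN _ _ (exMN i)).
Qed.

End Main.

Theorem theorem3p4 (k : fieldType) (c : nat) (a : 'I_c -> nat) (q : 'M[k]_c)
    (c_ge1 : (1 <= c)%N) (a_ge2 : forall i, (2 <= a i)%N)
    (q_comm : commutation_matrix q)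
    (q_roots : forall i j, exists2 n, (0 < n)%N & n.-unity_root (q i j))
    (M N : lmodType (qci q a_ge2))
    (M_fg : finitely_generated M) (N_fg : finitely_generated N)
    (M_gr : grading M) (N_gr : grading N) :
  [<-> exists n0 : nat, forall i, (n0 <= i)%N -> Ext_vanishes i M N;
       forall i, (0 < i)%N -> Ext_vanishes i M N;
       exists n0 : nat, forall i, (n0 <= i)%N -> Ext_vanishes i N M;
       forall i, (0 < i)%N -> Ext_vanishes i N M].
Proof.
(* Swapping twice returns to the original pair, which improves vanishing in large degrees to
   vanishing in all positive degrees. *)
have MN := Ext_vanishing_swap q_comm M_fg N_fg M_gr N_gr.
have NM := Ext_vanishing_swap q_comm N_fg M_fg N_gr M_gr.
tfae.
- by move=> van; apply: NM; exists 1%N; exact: MN.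
- by move=> van; exists 1%N; apply: MN; exists 1%N.
- by move=> van; apply: MN; exists 1%N; exact: NM.
- by move=> van; exists 1%N; apply: NM; exists 1%N.
Qed.
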